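(* For an integer $k\ge 2$, let $$\lambda_k^{\mathrm{2nd}}\equiv\inf_{q\in(0,1)}\sqrt{-\frac{k}{2q^k}\log(1-q^2)}\,,$$ i.e. $\lambda_k^{\mathrm{2nd}}=(k/2)^{1/2}\beta_k^{\mathrm{2nd}}$ where $\beta_k^{\mathrm{2nd}}\equiv\inf_{q\in(0,1)}\sqrt{-\frac{1}{q^k}\log(1-q^2)}$. Let $\lambda\ge 0$ be fixed (independent of $n$) and assume $\lambda<\lambda_k^{\mathrm{2nd}}$. Then, for any $k\ge 3$, $$\lim_{n\to\infty}\|\mathbb{P}_\lambda-\mathbb{P}_0\|_{\mathrm{TV}}=0\,.$$ Further, for $k=2$ and $\lambda<\lambda_2^{\mathrm{2nd}}=1$, $\mathbb{P}_\lambda$ is contiguous with respect to $\mathbb{P}_0$ (as $n\to\infty$).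
   Context: Let $\mathbf{Z}\in\bigotimes^k\mathbb{R}^n$ be the asymmetric standard normal noise tensor, i.e. the tensor whose entries $\mathbf{Z}_{i_1,\dots,i_k}$, $(i_1,\dots,i_k)\in[n]^k$, are i.i.d. $\mathsf{N}(0,1/n)$. Given $\lambda\in\mathbb{R}_{\ge 0}$, let $\mathbf{X}=\lambda\,\mathbf{v}_1\otimes\mathbf{v}_2\otimes\cdots\otimes\mathbf{v}_k+\mathbf{Z}\in\bigotimes^k\mathbb{R}^n$, where $\mathbf{v}_1,\dots,\mathbf{v}_k$ are independent and uniformly distributed on the unit sphere $\mathbb{S}^{n-1}=\{\mathbf{x}\in\mathbb{R}^n:\|\mathbf{x}\|_2=1\}$, and independent of $\mathbf{Z}$. Let $\mathbb{P}_\lambda=\mathbb{P}_\lambda^{(k)}$ (depending also on $n$) denote the law of $\mathbf{X}$; thus $\mathbb{P}_0$ is the law of $\mathbf{Z}$. Total variation distance: $\|\mathbb{P}-\mathbb{Q}\|_{\mathrm{TV}}=\sup_A|\mathbb{P}(A)-\mathbb{Q}(A)|$, the supremum being over measurable sets. Contiguity: for each $n$ let $\mathbb{P}_{0,n},\mathbb{P}_{1,n}$ be two probability measures on the same measurable space $(\Omega_n,\mathcal{F}_n)$. The sequence $(\mathbb{P}_{1,n})$ is contiguous with respect to $(\mathbb{P}_{0,n})$ if for any sequence of events $A_n\in\mathcal{F}_n$, $\lim_{n\to\infty}\mathbb{P}_{0,n}(A_n)=0$ implies $\lim_{n\to\infty}\mathbb{P}_{1,n}(A_n)=0$. Contiguity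 of $\mathbb{P}_\lambda$ with respect to $\mathbb{P}_0$ refers to the corresponding sequences indexed by $n$. *)

(* Defs.v *)
From mathcomp Require Export all_boot all_order all_algebra.
From mathcomp Require Export all_classical all_reals all_analysis.

Set Implicit Arguments.
Unset Strict Implicit.
Unset Printing Implicit Defensive.

Export Order.TTheory GRing.Theory Num.Theory.
Export numFieldNormedType.Exports.

Local Open Scope classical_set_scope.
Local Open Scope ring_scope.

Definition beta_2nd (R : realType) (k : nat) : R :=
  inf [set Num.sqrt (- (q ^+ k)^-1 * ln (1 - q ^+ 2)) | q in `]0, 1[].

Definition lambda_2nd (R : realType) (k : nat) : R :=
  inf [set Num.sqrt (- (k%:R / (2 * q ^+ k)) * ln (1 - q ^+ 2)) | q in `]0, 1[].

Definition total_variation d (T : measurableType d) (R : realType)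
    (P Q : probability T R) : R :=
  sup [set `|fine (P A) - fine (Q A)| | A in @measurable d T].

Definition contiguous (R : realType) (d : nat -> measure_display)
    (T : forall n, measurableType (d n)) (P1 P0 : forall n, probability (T n) R) :=
  forall A : forall n, set (T n), (forall n, measurable (A n)) ->
    P0 n (A n) @[n --> \oo] --> 0%E -> P1 n (A n) @[n --> \oo] --> 0%E.

(* Mutual independence of a finite family of set systems.  Random variables
   (possibly with different codomains) are independent when the
   sigma-algebras they generate are. *)
Definition mutually_independent d (T : measurableType d) (R : realType)
    (P : probability T R) (I : finType) (G : I -> set_system T) :=
  forall (J : {set I}) (A : I -> set T),
    (forall i, i \in J -> G i (A i)) ->
    P (\bigcap_(i in [set` J]) A i) = (\prod_(i in J) fine (P (A i)))%:E.

(* Vectors of R^n are n-tuples, which carry the product sigma-algebra. *)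
Definition unit_sphere (R : realType) (n : nat) : set (n.-tuple R) :=
  [set x | Num.sqrt (\sum_(i < n) tnth x i ^+ 2) = 1].

Definition mx_act (R : realType) (n : nat) (O : 'M[R]_n) (x : n.-tuple R) :
    n.-tuple R :=
  [tuple \sum_(j < n) O i j * tnth x j | i < n].

(* The uniform distribution on the sphere is the unique probability measure
   carried by the sphere and invariant under the orthogonal group. *)
Definition uniform_on_sphere (R : realType) (n : nat)
    (mu : probability (n.-tuple R) R) :=
  mu (@unit_sphere R n) = 1%E /\
  forall O : 'M[R]_n, O *m O^T = 1%:M ->
  forall A, measurable A -> mu (mx_act O @^-1` A) = mu A.

(* A k-tensor over R^n is the tuple of its n ^ k entries, listed along the
   enumeration of the multi-indices (i_1, ..., i_k); its sigma-algebra is again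
   the product one. *)
Definition tensor (R : realType) (k n : nat) := #|{: k.-tuple 'I_n}|.-tuple R.

Definition tensor_of (R : realType) (k n : nat) (f : k.-tuple 'I_n -> R) :
    tensor R k n :=
  [tuple f (enum_val a) | a < #|{: k.-tuple 'I_n}|].

Definition rank_one (R : realType) (k n : nat) (v : 'I_k -> n.-tuple R)
    (i : k.-tuple 'I_n) : R :=
  \prod_(j < k) tnth (v j) (tnth i j).

(* mu is the law of lambda v_1 (x) ... (x) v_k + Z, where the entries of Z and
   the vectors v_1, ..., v_k form one mutually independent family: this amounts
   to independence of the entries, independence of the vectors and independence
   of (v_1, ..., v_k) from Z.  The law of the pair (Z, v), hence mu, is
   determined by these conditions. *)
Definition spiked_tensor_law (R : realType) (k n : nat) (lambda : R)
    (mu : probability (tensor R k n) R) : Prop :=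
  exists (d : measure_display) (Omega : measurableType d)
    (P : probability Omega R)
    (Z : k.-tuple 'I_n -> {RV P >-> R})
    (v : 'I_k -> {RV P >-> n.-tuple R}),
    [/\ forall i A, measurable A ->
          distribution P (Z i) A = normal_prob 0 (Num.sqrt n%:R^-1) A,
        forall j, uniform_on_sphere (distribution P (v j)),
        mutually_independent P (fun s : k.-tuple 'I_n + 'I_k =>
          match s with
          | inl i => g_sigma_algebra_preimage (Z i)
          | inr j => g_sigma_algebra_preimage (v j)
          end)
      & forall A, measurable A ->
          mu A = P ((fun w => tensor_of (fun i =>
            lambda * rank_one (fun j => v j w) i + Z i w)) @^-1` A)].

(* Main.v *)
From HB Require Import structures.
From mathcomp Require Import measurable_realfun ring lra.
Require Import Defs.

(** The proof is the second moment method.  Conditionally on the signal the law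
    of the spiked tensor is a translate of the Gaussian law, hence has an
    explicit density with respect to it ([cameron_martin]); averaging that
    density over the signal gives the likelihood ratio L of the spiked law with
    respect to the pure noise law P.  Since the integral of L is 1, the integral
    of L ^ 2 measures how far L is from 1, and [second_moment_bound] converts it
    into the inequality

      P_lambda A <= (1 + e) P A + delta / (4 e)    for all e > 0,

    where 1 + delta bounds the integral of L ^ 2.  Letting delta and e go to 0
    gives convergence in total variation (the reverse inequality comes from the
    complement of A); keeping delta bounded and taking e large gives
    contiguity.

    Two independent signals v, v' make the integral of L ^ 2 equal to the mean
    of exp (n lambda ^ 2 X), where the overlap X is the product over j of the
    inner products <v_j, v'_j>.  The odd moments of X vanish, and its moment of
    order 2 m is the k-th power of the moment

      prod_(i < m) (2 i + 1) / (n + 2 i)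

    of one inner product, which invariance under the orthogonal group
    determines.  Expanding the exponential turns the second moment into the
    explicit series of the terms

      (n lambda ^ 2) ^ (2 m) / (2 m)! * (prod_(i < m) (2 i + 1) / (n + 2 i)) ^ k

    ([integral_exp_overlap]), whose term of index 0 is 1.

    For k = 2 the term of index m is at most lambda ^ (4 m), so the series is
    bounded as soon as lambda < 1 ([chi_term2_le]).  For k >= 3 each term of
    positive index tends to 0 ([chi_term_crude]), and a bound that is geometric
    in m uniformly in n is needed to exchange limit and sum.  The sphere moment
    is at most a constant times m times the maximum over q of
    q ^ (2 m) (1 - q ^ 2) ^ (n / 2) ([sphere_moment_le]).  At the q where the
    maximum is attained, the definition of the critical value bounds
    n lambda_k ^ 2 q ^ k by x = - (n k / 2) ln (1 - q ^ 2), so that the term of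
    index m for lambda = theta lambda_k is, up to a constant and a power of m,
    at most theta ^ (4 m) * x ^ (2 m) / (2 m)! * exp (- x), where the exponential
    compensates x ^ (2 m) / (2 m)! ([chi_term_geometric]). *)

Set Implicit Arguments.
Unset Strict Implicit.
Unset Printing Implicit Defensive.

Local Open Scope classical_set_scope.
Local Open Scope ring_scope.

(** * Measures with a density *)

Section density.
Local Open Scope ereal_scope.
Context d (T : measurableType d) (R : realType).
Variables (m : {measure set T -> \bar R}) (F : T -> R).
Hypotheses (mF : measurable_fun setT F) (F0 : forall x, (0 <= F x)%R).

Lemma density_measure : exists nu : {measure set T -> \bar R},
  forall A, measurable A -> nu A = \int[m]_(x in A) (F x)%:E.
Proof.
pose nu A := \int[m]_(x in A) (F x)%:E.
have nu0 : nu set0 = 0 by rewrite /nu integral_set0.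
have nu_ge0 A : 0 <= nu A by apply: integral_ge0 => x _; rewrite lee_fin.
have nu_sigma : semi_sigma_additive nu.
  move=> G mG tG mUG; rewrite /nu ge0_integral_bigcup//.
  - by apply: is_cvg_ereal_nneg_natsum => n _; exact: nu_ge0.
  - by apply: (measurable_funS measurableT) => //; exact/measurable_EFinP.
  - by move=> x _; rewrite lee_fin.
pose h := isMeasure.Build _ _ _ nu nu0 nu_ge0 nu_sigma.
pose nu' : {measure set T -> \bar R} := HB.pack nu h.
by exists nu'.
Qed.

Import HBNNSimple.

(** By monotone convergence through simple functions, for which the identity is
    the hypothesis. *)
Lemma integral_density (nu : {measure set T -> \bar R}) (f : T -> \bar R) :
  (forall A, measurable A -> nu A = \int[m]_(x in A) (F x)%:E) ->
  measurable_fun setT f -> (forall x, 0 <= f x) ->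
  \int[nu]_x f x = \int[m]_x (f x * (F x)%:E).
Proof.
move=> nuE mf f0; pose h := nnsfun_approx measurableT mf.
have cvgh x : EFin \o h^~ x @ \oo --> f x by exact: cvg_nnsfun_approx.
have mh n : measurable_fun setT (EFin \o h n) by exact/measurable_EFinP.
have mFE : measurable_fun setT (EFin \o F) by exact/measurable_EFinP.
transitivity (limn (fun n => \int[nu]_x (h n x)%:E)).
  rewrite -monotone_convergence//.
  - by apply: eq_integral => x _; apply/esym/cvg_lim => //; exact: cvgh.
  - by move=> n x _; rewrite lee_fin.
  - by move=> x _ a b ab; rewrite lee_fin; exact/lefP/nd_nnsfun_approx.
transitivity (limn (fun n => \int[m]_x ((h n x)%:E * (F x)%:E))); last first.
  rewrite -monotone_convergence//.
  - apply: eq_integral => x _; apply/cvg_lim => //.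
    by apply: cvgeZr => //; exact: cvgh.
  - by move=> n; apply: emeasurable_funM => //; exact: mh.
  - by move=> n x _; rewrite mule_ge0// lee_fin.
  - move=> x _ a b ab; rewrite lee_wpmul2r ?lee_fin//.
    exact/lefP/nd_nnsfun_approx.
congr (limn _); apply/funext => n.
transitivity (\int[nu]_x (\sum_(y \in range (h n))
    (y * \1_(h n @^-1` [set y]) x)%:E)).
  by apply: eq_integral => t _; rewrite /= fimfunE -fsumEFin.
have indich r : measurable_fun setT (fun x => (r * \1_(h n @^-1` [set r]) x)%:E).
  by apply/measurable_EFinP; exact: measurable_funM.
rewrite ge0_integral_fsum//; last by move=> y x _; exact: nnfun_muleindic_ge0.
transitivity (\int[m]_x (\sum_(y \in range (h n))
    (y * \1_(h n @^-1` [set y]) x)%:E * (F x)%:E)); last first.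
  apply: eq_integral => x _.
  rewrite -ge0_mule_fsuml => [|y]; last exact: nnfun_muleindic_ge0.
  by rewrite fsumEFin// -(fimfunE _ x).
rewrite ge0_integral_fsum//; last 2 first.
  - by move=> y; exact: emeasurable_funM.
  - by move=> y x _; rewrite mule_ge0// ?lee_fin//; exact: nnfun_muleindic_ge0.
apply: eq_fsbigr => r rhn.
under eq_integral do rewrite EFinM.
rewrite integralZl_indic_nnsfun => //.
under [RHS]eq_integral do rewrite EFinM -muleA.
rewrite ge0_integralZl//.
- rewrite integral_indic// setIT nuE// [in LHS]integral_mkcond.
  congr (_ * _); apply: eq_integral => x _.
  by rewrite epatch_indic muleC.
- by apply: emeasurable_funM => //; exact/measurable_EFinP.
- by move=> t _; rewrite mule_ge0// lee_fin.
- by move: rhn; rewrite inE => -[t _ <-]; rewrite lee_fin.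
Qed.

End density.

(** Packs the image measure so that its defining equation is all that later
    proofs see of it. *)
Lemma pushforward_measure d d' (S : measurableType d) (T : measurableType d')
    (R : realType) (m : {measure set S -> \bar R}) (f : S -> T) :
  measurable_fun setT f ->
  exists nu : {measure set T -> \bar R}, forall A, nu A = m (f @^-1` A).
Proof.
move=> mf; pose f' : {mfun S >-> T} := HB.pack f (isMeasurableFun.Build _ _ _ _ f mf).
pose nu : {measure set T -> \bar R} := pushforward m f'.
by exists (nu mf).
Qed.

(** Independence is used through this statement: there F is a product of
    functions of the other coordinates, and [rho] a multiple of the law of X. *)
Lemma integral_weighted_law d d' (T : measurableType d) (S : measurableType d')
    (R : realType) (m : {measure set T -> \bar R}) (F : T -> R)
    (X : T -> S) (rho : {measure set S -> \bar R}) (f : S -> \bar R) :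
  measurable_fun setT F -> (forall x, 0 <= F x) -> measurable_fun setT X ->
  (forall B, measurable B -> (\int[m]_(x in X @^-1` B) (F x)%:E = rho B)%E) ->
  measurable_fun setT f -> (forall s, 0 <= f s)%E ->
  (\int[m]_x (f (X x) * (F x)%:E) = \int[rho]_s f s)%E.
Proof.
move=> mF F0 mX FXE mf f0.
have [nu nuE] := density_measure m mF F0.
have mfX : measurable_fun setT (f \o X) by exact: measurableT_comp.
rewrite -(integral_density mF F0 nuE mfX)//; last by move=> x /=.
transitivity (\int[pushforward nu X]_s f s)%E.
  by rewrite (ge0_integral_pushforward mX).
apply: eq_measure_integral => A mA _.
rewrite -FXE// -nuE//.
by rewrite -[X in measurable X]setTI; exact: (mX measurableT _ mA).
Qed.

(** * Measures on tuples and product laws *)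

Definition rectangle (T : Type) (n : nat) (B : 'I_n -> set T) : set (n.-tuple T) :=
  [set x | forall i, B i (tnth x i)].

Lemma rectangleT (T : Type) (n : nat) :
  rectangle (fun=> setT) = [set: n.-tuple T].
Proof. by apply/seteqP; split. Qed.

Section tuple_measure.
Context d (T : measurableType d) (n : nat).

Lemma measurable_rectangle (B : 'I_n -> set T) :
  (forall i, measurable (B i)) -> measurable (rectangle B).
Proof.
move=> mB.
have -> : rectangle B = \bigcap_(i in [set: 'I_n]) ((@tnth n T)^~ i @^-1` B i).
  by apply/seteqP; split => [x Bx i _|x Bx i]; [exact: Bx|exact: (Bx i I)].
apply: fin_bigcap_measurable => // i _.
by rewrite -[X in measurable X]setTI; exact: (measurable_tnth i measurableT (mB i)).
Qed.

(** Rectangles are stable under intersection and generate the product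
    sigma-algebra, so the pi-lambda theorem applies. *)
Lemma tuple_measure_eq (R : realType) (m1 m2 : {measure set (n.-tuple T) -> \bar R}) :
  (m1 setT < +oo)%E ->
  (forall B, (forall i, measurable (B i)) -> m1 (rectangle B) = m2 (rectangle B)) ->
  forall A, measurable A -> m1 A = m2 A.
Proof.
move=> m1oo m12 A mA.
pose G := [set C | exists2 B : 'I_n -> set T,
  forall i, measurable (B i) & C = rectangle B].
apply: (measure_unique G (fun=> setT)) => //.
- apply/seteqP; split; last first.
    apply: smallest_sub; first exact: sigma_algebra_measurable.
    by move=> _ [B mB ->]; exact: measurable_rectangle.
  apply: smallest_sub; first exact: smallest_sigma_algebra.
  rewrite -bigcup_seq => C [i _ [D mD <-]]; apply: sub_sigma_algebra.
  exists (fun j => if j == i then D else setT).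
    by move=> j; case: ifP.
  rewrite setTI; apply/seteqP; split => [x Dx j|x /(_ i)/=].
    by case: eqP => // ->.
  by rewrite eqxx.
- move=> _ _ [B mB ->] [C mC ->]; exists (fun i => B i `&` C i).
    by move=> i; exact: measurableI.
  apply/seteqP; split => [x [Bx Cx] i|x BCx]; first by split; [exact: Bx|exact: Cx].
  by split => i; have [] := BCx i.
- by move=> _; exists (fun=> setT) => //; rewrite rectangleT.
- by rewrite bigcup_const.
- by move=> _ [B mB ->]; exact: m12.
Qed.

End tuple_measure.

Definition product_law d (T : measurableType d) (R : realType) (n : nat)
    (rho : 'I_n -> probability T R) (nu : set (n.-tuple T) -> \bar R) :=
  forall B, (forall i, measurable (B i)) ->
    nu (rectangle B) = (\prod_(i < n) fine (rho i (B i)))%:E.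

(** On indicator functions this is the definition of a product law.  The
    indicators are replaced by the given functions one coordinate at a time:
    when all other coordinates are fixed, the integral is a measure in the set
    that defines the indicator, proportional to the law of that coordinate. *)
Lemma integral_product_law d (T : measurableType d) (R : realType) (n : nat)
    (rho : 'I_n -> probability T R) (nu : {measure set (n.-tuple T) -> \bar R})
    (g : 'I_n -> T -> R) (c : 'I_n -> R) :
  product_law rho nu ->
  (forall i, measurable_fun setT (g i)) -> (forall i x, 0 <= g i x) ->
  (forall i, \int[rho i]_x (g i x)%:E = (c i)%:E)%E ->
  (\int[nu]_x (\prod_(i < n) g i (tnth x i))%:E = (\prod_(i < n) c i)%:E)%E.
Proof.
move=> nuE.
suff H (s : seq 'I_n) : forall (g : 'I_n -> T -> R) (c : 'I_n -> R),
    (forall i, i \notin s -> exists2 B, measurable B & g i = \1_B) ->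
    (forall i, measurable_fun setT (g i)) -> (forall i x, 0 <= g i x) ->
    (forall i, \int[rho i]_x (g i x)%:E = (c i)%:E)%E ->
    (\int[nu]_x (\prod_(i < n) g i (tnth x i))%:E = (\prod_(i < n) c i)%:E)%E.
  by apply: (H (enum 'I_n)) => i; rewrite mem_enum.
elim: s => [|j s IH] {}g {}c gB mg g0 gc.
  have {}gB i : exists B, measurable B /\ g i = \1_B.
    by have [//|B mB gE] := gB i; exists B.
  have [B mgB] := choice gB.
  have mB i := (mgB i).1; have gE i := (mgB i).2.
  transitivity (\int[nu]_x (\1_(rectangle B) x)%:E)%E.
    apply: eq_integral => x _; congr EFin.
    under eq_bigr do rewrite gE indicE.
    rewrite indicE; have [Bx|nBx] := pselect (rectangle B x).
      by rewrite mem_set//= big1// => i _; rewrite mem_set//; exact: Bx.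
    rewrite memNset//=; move/existsNP : nBx => [i nBx].
    by rewrite (bigD1 i)//= memNset// mul0r.
  rewrite integral_indic//; last exact: measurable_rectangle.
  rewrite setIT nuE//; congr EFin; apply: eq_bigr => i _.
  have := gc i; rewrite gE integral_indic// setIT => ->//.
(* The integral over the other coordinates becomes a weight for coordinate j. *)
pose F (x : n.-tuple T) := \prod_(i < n | i != j) g i (tnth x i).
have c0 i : 0 <= c i.
  by rewrite -lee_fin -gc; apply: integral_ge0 => x _; rewrite lee_fin.
have C0 : 0 <= \prod_(i < n | i != j) c i by exact: prodr_ge0.
have mF : measurable_fun setT F.
  rewrite /F; under eq_fun do rewrite big_mkcond/=.
  apply: measurable_prod => i _; case: (i != j) => //=.
  by apply: measurableT_comp => //; exact: measurable_tnth.
transitivity (\int[nu]_x ((g j (tnth x j))%:E * (F x)%:E))%E.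
  by apply: eq_integral => x _; rewrite (bigD1 j)//= EFinM.
rewrite (integral_weighted_law (X := (@tnth n T)^~ j)
  (rho := mscale (NngNum C0) (rho j)) (f := EFin \o g j))//.
- rewrite ge0_integral_mscale//.
  + by rewrite gc -EFinM [in RHS](bigD1 j)//= mulrC.
  + exact/measurable_EFinP.
  + by move=> x _; rewrite lee_fin.
- by move=> x; exact: prodr_ge0.
- exact: measurable_tnth.
- move=> B mB.
  pose g' i := if i == j then \1_B else g i.
  pose c' i := if i == j then fine (rho j B) else c i.
  transitivity (\int[nu]_x (\prod_(i < n) g' i (tnth x i))%:E)%E.
    rewrite integral_mkcond; apply: eq_integral => x _.
    rewrite epatch_indic -EFinM; congr EFin.
    rewrite [in RHS](bigD1 j)//= /g' eqxx mulrC; congr (_ * _).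
    by apply: eq_bigr => i /negPf ->.
  rewrite (IH g' c').
  + rewrite (bigD1 j)//= /c' eqxx.
    under eq_bigr => i /negPf -> do [].
    by rewrite EFinM fineK ?fin_num_measure// muleC.
  + move=> i si; rewrite /g'; case: eqP => [_|/eqP ij]; first by exists B.
    by apply: gB; rewrite inE negb_or ij.
  + by move=> i; rewrite /g'; case: ifP.
  + by move=> i x; rewrite /g'; case: ifP.
  + move=> i; rewrite /g' /c'; case: eqP => [->|//].
    by rewrite integral_indic// setIT fineK ?fin_num_measure.
- exact/measurable_EFinP.
- by move=> x; rewrite lee_fin.
Qed.

Lemma product_law_unique d (T : measurableType d) (R : realType) (n : nat)
    (rho : 'I_n -> probability T R) (nu1 nu2 : {measure set (n.-tuple T) -> \bar R}) :
  product_law rho nu1 -> product_law rho nu2 ->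
  forall A, measurable A -> nu1 A = nu2 A.
Proof.
move=> nu1E nu2E; apply: tuple_measure_eq => [|B mB]; last by rewrite nu1E ?nu2E.
by rewrite -rectangleT nu1E ?ltry.
Qed.

(** * Translations of Gaussian vectors *)

Section gaussian.
Context (R : realType).
Notation mu := (@lebesgue_measure R).

(** Translation preserves the length of intervals, which characterizes Lebesgue
    measure. *)
Lemma lebesgue_measure_translation (y : R) (A : set R) : measurable A ->
  mu ((fun x => x + y) @^-1` A) = mu A.
Proof.
move=> mA; pose f : measurableTypeR R -> measurableTypeR R := fun x => x + y.
have mf : measurable_fun setT f by exact: measurable_funD.
have [muf mufE] := pushforward_measure mu mf.
apply/esym; rewrite -[RHS]mufE.
apply: lebesgue_measure_unique => //= _ [[a b]] _ <-.
have -> : muf `]a, b]%classic = mu `](a - y), (b - y)]%classic.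
  rewrite mufE; congr (mu _); apply/seteqP.
  by split => x; rewrite /= !in_itv/= /f ltrBlDr lerBrDr.
rewrite !lebesgue_measure_itv/= !lte_fin ltrD2r.
by case: ifP => // _; rewrite -!EFinB; congr EFin; ring.
Qed.

Variable n : nat.
Hypothesis n0 : (0 < n)%N.
Variable N : probability R R.
Hypothesis NE : forall A, measurable A ->
  N A = normal_prob 0 (Num.sqrt n%:R^-1) A.

(** The density of a translate by y of the centred normal law of variance 1 / n
    with respect to that law. *)
Definition tilt1 (y x : R) := expR (n%:R * y * x - n%:R * y ^+ 2 / 2).

Lemma measurable_tilt1 y : measurable_fun setT (tilt1 y).
Proof.
apply: measurableT_comp => //; apply: measurable_funB => //.
Qed.

Lemma normal_pdf_tilt1 y x :
  normal_pdf 0 (Num.sqrt n%:R^-1) (x - y) =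
  tilt1 y x * normal_pdf 0 (Num.sqrt n%:R^-1) x.
Proof.
have nR0 : n%:R != 0 :> R by rewrite pnatr_eq0 -lt0n.
have s0 : Num.sqrt (n%:R^-1) != 0 :> R.
  by rewrite gt_eqF// sqrtr_gt0 invr_gt0 ltr0n.
rewrite normal_pdfE// mulrCA; congr (_ * _).
rewrite /normal_fun -expRD sqr_sqrtr ?invr_ge0//; congr expR.
by field.
Qed.

Lemma normal_prob_translation y (A : set R) : measurable A ->
  N ((fun x => x + y) @^-1` A) = (\int[N]_(x in A) (tilt1 y x)%:E)%E.
Proof.
move=> mA; pose p := normal_pdf (0 : R) (Num.sqrt n%:R^-1).
have mp : measurable_fun setT p by exact: measurable_normal_pdf.
have p0 x : 0 <= p x by exact: normal_pdf_ge0.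
have mt := measurable_tilt1 y.
have mTE : measurable_fun setT ((EFin \o tilt1 y) \_ A).
  apply/(measurable_restrictT _ _).1 => //.
  by apply: measurable_funTS; exact/measurable_EFinP.
have mpy : measurable_fun setT (fun x : R => (p (x - y))%:E).
  by apply/measurable_EFinP; apply: measurableT_comp => //; exact: measurable_funB.
rewrite NE; last first.
  have mf : measurable_fun setT (fun x : R => x + y) by exact: measurable_funD.
  by rewrite -[X in measurable X]setTI; exact: (mf measurableT _ mA).
have mid : measurable_fun setT (idfun : measurableTypeR R -> R).
  by move=> _ Y mY; rewrite setTI.
transitivity (\int[pushforward (normal_prob 0 (Num.sqrt n%:R^-1))
    (idfun : measurableTypeR R -> R)]_(x in A) (tilt1 y x)%:E)%E; last first.
  by apply: eq_measure_integral => B mB _; exact/esym/NE.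
rewrite (ge0_integral_pushforward mid)//; last 2 first.
- by apply: measurable_funTS; exact/measurable_EFinP.
- by move=> x _; rewrite lee_fin expR_ge0.
rewrite preimage_id [RHS]integral_mkcond.
rewrite (integral_density (F := p) (m := mu))//; last first.
  by move=> x; apply: erestrict_ge0 => z _; rewrite lee_fin expR_ge0.
transitivity (\int[mu]_(x in A) (p (x - y))%:E)%E; last first.
  rewrite [LHS]integral_mkcond; apply: eq_integral => x _.
  by rewrite /patch; case: ifP => _; rewrite ?mul0e// -EFinM /p normal_pdf_tilt1.
pose f : measurableTypeR R -> measurableTypeR R := fun x => x + y.
have mf : measurable_fun setT f by exact: measurable_funD.
transitivity (\int[pushforward mu f]_(x in A) (p (x - y))%:E)%E.
  rewrite (ge0_integral_pushforward mf).
  - by apply: eq_integral => x _; rewrite /= /f addrK.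
  - by [].
  - exact: (measurable_funS measurableT (@subsetT _ _) mpy).
  - by move=> x _; rewrite lee_fin.
by apply: eq_measure_integral => B mB _; exact: lebesgue_measure_translation.
Qed.

Variable m : nat.
Implicit Types (y : 'I_m -> R) (z : m.-tuple R).

Definition tilt y z := \prod_(i < m) tilt1 (y i) (tnth z i).
Definition shift y z : m.-tuple R := [tuple y i + tnth z i | i < m].

Lemma tilt_ge0 y z : 0 <= tilt y z.
Proof. by apply: prodr_ge0 => i _; exact: expR_ge0. Qed.

Lemma measurable_tilt y : measurable_fun setT (tilt y).
Proof.
apply: measurable_prod => i _; apply: measurableT_comp.
  exact: measurable_tilt1.
exact: measurable_tnth.
Qed.

Lemma measurable_shift y : measurable_fun setT (shift y).
Proof.
apply/measurable_fun_tnthP => i /=.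
rewrite (_ : _ \o _ = fun z => y i + tnth z i); last first.
  by apply/funext => z; rewrite /= tnth_mktuple.
by apply: measurable_funD => //; exact: measurable_tnth.
Qed.

(** Both sides are measures in A, so it suffices to compare them on rectangles,
    where they factor into their one-dimensional versions. *)
Lemma cameron_martin (nu : {measure set (m.-tuple R) -> \bar R}) y A :
  product_law (fun=> N) nu -> measurable A ->
  nu (shift y @^-1` A) = (\int[nu]_(z in A) (tilt y z)%:E)%E.
Proof.
move=> nuE mA.
have [nuy nuyE] := density_measure nu (measurable_tilt y) (tilt_ge0 y).
have [nus nusE] := pushforward_measure nu (measurable_shift y).
rewrite -nuyE// -nusE.
apply: tuple_measure_eq mA => [|B mB].
  rewrite nusE preimage_setT.
  by rewrite -rectangleT nuE ?ltry.
have mBy i : measurable ((fun x => x + y i) @^-1` B i).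
  have mf : measurable_fun setT (fun x : R => x + y i) by exact: measurable_funD.
  by rewrite -[X in measurable X]setTI; exact: (mf measurableT _ (mB i)).
rewrite nuyE; last exact: measurable_rectangle.
transitivity (nu (rectangle (fun i => (fun x => x + y i) @^-1` B i))).
  rewrite nusE; congr (nu _); apply/seteqP; split => z Bz i /=.
    by have := Bz i; rewrite /= tnth_mktuple addrC.
  by rewrite tnth_mktuple addrC; exact: Bz.
rewrite nuE//.
pose g i x := tilt1 (y i) x * \1_(B i) x.
have mg i : measurable_fun setT (g i).
  by apply: measurable_funM; [exact: measurable_tilt1|exact: measurable_indic].
rewrite integral_mkcond.
transitivity (\int[nu]_x (\prod_(i < m) g i (tnth x i))%:E)%E; last first.
  apply: eq_integral => z _; rewrite epatch_indic -EFinM; congr EFin.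
  rewrite /g big_split/=; congr (_ * _).
  rewrite indicE; have [Bz|nBz] := pselect (rectangle B z).
    by rewrite mem_set//= big1// => i _; rewrite indicE mem_set//; exact: Bz.
  rewrite memNset//=; move/existsNP : nBz => [i nBz].
  by rewrite (bigD1 i)//= indicE memNset// mul0r.
apply/esym; apply: (integral_product_law (rho := fun=> N)) => //.
- by move=> i x; rewrite mulr_ge0// expR_ge0.
- move=> i; rewrite fineK ?fin_num_measure// normal_prob_translation//.
  rewrite [RHS]integral_mkcond; apply: eq_integral => x _.
  by rewrite epatch_indic EFinM.
Qed.

(** The product of two tilts is a constant multiple of the tilt by the sum of
    the translations, and every tilt has integral 1. *)
Lemma integral_tilt2 (nu : {measure set (m.-tuple R) -> \bar R}) y y' :
  product_law (fun=> N) nu ->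
  (\int[nu]_z (tilt y z * tilt y' z)%:E =
   (expR (n%:R * \sum_(i < m) y i * y' i))%:E)%E.
Proof.
move=> nuE.
pose e := expR (n%:R * \sum_(i < m) y i * y' i).
transitivity (\int[nu]_z (e%:E * (tilt (fun i => (y i + y' i)%R) z)%:E))%E.
  apply: eq_integral => z _; rewrite -EFinM; congr EFin.
  rewrite /e mulr_sumr expR_sum /tilt -!big_split/=.
  by apply: eq_bigr => i _; rewrite /tilt1 -!expRD; congr expR; field.
rewrite ge0_integralZl//; last 3 first.
- by apply/measurable_EFinP; exact: measurable_tilt.
- by move=> z _; rewrite lee_fin tilt_ge0.
- by rewrite lee_fin expR_ge0.
rewrite -cameron_martin// preimage_setT.
rewrite -rectangleT nuE//= big1 ?mule1// => i _.
by rewrite probability_setT.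
Qed.

End gaussian.

(** * Inner products and reflections *)

Definition dot (R : realType) (n : nat) (x y : n.-tuple R) : R :=
  \sum_(i < n) tnth x i * tnth y i.

Section dot.
Context (R : realType) (n : nat).
Implicit Types x y v : n.-tuple R.

Lemma dot_ge0 x : 0 <= dot x x.
Proof. by apply: sumr_ge0 => i _; rewrite -expr2 sqr_ge0. Qed.

Lemma unit_sphereE v : unit_sphere v <-> dot v v = 1.
Proof.
rewrite /unit_sphere /=.
have -> : \sum_(i < n) tnth v i ^+ 2 = dot v v by apply: eq_bigr => i _.
split => [vv|->]; last by rewrite sqrtr1.
by rewrite -[LHS](sqr_sqrtr (dot_ge0 v)) vv expr1n.
Qed.

(** The reflection in the hyperplane orthogonal to x - y exchanges two vectors
    x and y of the same norm. *)
Lemma reflection_exists x y : dot x x = dot y y ->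
  exists2 O : 'M[R]_n, O *m O^T = 1%:M & forall v, dot x (mx_act O v) = dot y v.
Proof.
move=> xy; pose u := \col_(i < n) (tnth x i - tnth y i).
pose q := \sum_(i < n) u i 0 ^+ 2.
(* The norms of x and y agree, hence the factor 2. *)
have qE : q = 2 * (dot x x - dot x y).
  transitivity (dot x x + dot y y - 2 * dot x y); last by rewrite -xy; ring.
  rewrite /q /dot mulr_sumr -big_split/= -sumrB; apply: eq_bigr => i _.
  by rewrite mxE; ring.
have [q0|q0] := eqVneq q 0.
  have u0 i : u i 0 = 0.
    apply/eqP; rewrite -sqrf_eq0; apply/eqP.
    by apply: (psumr_eq0P _ q0) => // j _; exact: sqr_ge0.
  exists 1%:M; first by rewrite trmx1 mul1mx.
  move=> v; apply: eq_bigr => i _; congr (_ * _).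
    by have /eqP := u0 i; rewrite mxE subr_eq0 => /eqP.
  rewrite tnth_mktuple (bigD1 i)//= mxE eqxx mul1r big1 ?addr0// => j ji.
  by rewrite mxE eq_sym (negPf ji) mul0r.
have uu : u^T *m u = q%:M.
  apply/matrixP => i j; rewrite !ord1 !mxE mulr1n.
  by apply: eq_bigr => k _; rewrite !mxE expr2.
exists (1%:M - (2 / q) *: (u *m u^T)).
  have -> : (1%:M - (2 / q) *: (u *m u^T))^T = 1%:M - (2 / q) *: (u *m u^T).
    by rewrite linearB/= linearZ/= trmx_mul trmxK trmx1.
  rewrite mulmxBl mul1mx mulmxBr mulmx1 -scalemxAl -scalemxAr.
  rewrite -mulmxA (mulmxA u^T) uu mul_scalar_mx -scalemxAr !scalerA.
  have -> : 2 / q * (2 / q * q) = 2 / q + 2 / q by field.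
  by rewrite scalerDl opprB addrK subrK.
move=> v.
pose uv := \sum_(i < n) u i 0 * tnth v i.
have actE i : tnth (mx_act (1%:M - (2 / q) *: (u *m u^T)) v) i =
    tnth v i - 2 / q * u i 0 * uv.
  rewrite tnth_mktuple.
  under eq_bigr do rewrite !mxE big_ord1 !mxE mulrBl.
  rewrite sumrB (bigD1 i)//= eqxx mul1r big1 ?addr0; last first.
    by move=> j ji; rewrite eq_sym (negPf ji) mul0r.
  congr (_ - _); rewrite /uv mulr_sumr; apply: eq_bigr => j _.
  by rewrite !mxE; ring.
have uvE : uv = \sum_(i < n) u i 0 * tnth v i by [].
clearbody uv; rewrite /dot; under eq_bigr do rewrite actE mulrBr.
rewrite sumrB.
have -> : \sum_(i < n) tnth x i * (2 / q * u i 0 * uv) =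
    2 / q * (dot x x - dot x y) * uv.
  rewrite /dot -sumrB mulr_sumr mulr_suml; apply: eq_bigr => i _.
  by rewrite mxE; ring.
have -> : 2 / q * (dot x x - dot x y) = 1.
  by rewrite mulrAC -qE divff.
rewrite mul1r uvE -sumrB; apply: eq_bigr => i _.
by rewrite mxE; ring.
Qed.

Lemma measurable_dot x : measurable_fun setT (dot x).
Proof.
apply: measurable_sum => i; apply: measurable_funM => //.
exact: measurable_tnth.
Qed.

Lemma measurable_sqnorm : measurable_fun setT (fun v => dot v v).
Proof.
apply: measurable_sum => i.
by apply: measurable_funM; exact: measurable_tnth.
Qed.

Lemma measurable_unit_sphere : measurable (@unit_sphere R n).
Proof.
have -> : @unit_sphere R n = (fun v => dot v v) @^-1` [set 1].
  by apply/seteqP; split => v /unit_sphereE.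
rewrite -[X in measurable X]setTI.
exact: (measurable_sqnorm measurableT (measurable_set1 1)).
Qed.

Lemma measurable_mx_act (O : 'M[R]_n) : measurable_fun setT (mx_act O).
Proof.
apply/measurable_fun_tnthP => i.
rewrite (_ : _ \o _ = fun v => \sum_(j < n) O i j * tnth v j); last first.
  by apply/funext => v; rewrite /= tnth_mktuple.
apply: measurable_sum => j; apply: measurable_funM => //.
exact: measurable_tnth.
Qed.

End dot.

Section polynomial_identity.
Variable R : realType.

Lemma poly_eq_eval (p q : {poly R}) : (forall b, p.[b] = q.[b]) -> p = q.
Proof.
move=> pq; apply/eqP; rewrite -subr_eq0.
apply: contraT => pq0.
have := @max_poly_roots _ (p - q) [seq i%:R | i <- iota 0 (size (p - q))] pq0.
rewrite size_map size_iota ltnn => -> //.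
  by apply/allP => b _; rewrite /root !hornerE pq subrr.
by rewrite map_inj_uniq ?iota_uniq// => i j /eqP; rewrite eqr_nat => /eqP.
Qed.

Lemma coef2_1pX2_exp m : ((1 + 'X^2 : {poly R}) ^+ m)`_2 = m%:R.
Proof.
suff : ((1 + 'X^2 : {poly R}) ^+ m)`_2 = m%:R /\
       ((1 + 'X^2 : {poly R}) ^+ m)`_0 = 1 by case.
elim: m => [|m [IH2 IH0]]; first by rewrite expr0 !coef1.
rewrite exprS mulrDl mul1r !coefD !coefXnM/= IH2 IH0 addr0.
by split => //; rewrite -natr1.
Qed.

End polynomial_identity.

(** * Moments of the uniform law on the sphere *)

(** The moment of order 2 m of one coordinate of a uniform unit vector of R^n. *)
Definition sphere_moment (R : realType) (n m : nat) : R :=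
  \prod_(i < m) ((2 * i + 1)%:R / (n + 2 * i)%:R).

Section sphere_moments.
Context (R : realType) (n : nat) (rho : probability (n.-tuple R) R).
Hypothesis n0 : (0 < n)%N.
Hypothesis rhoU : uniform_on_sphere rho.
Notation S := (@unit_sphere R n).
Implicit Types x v : n.-tuple R.

Let rhoS : rho S = 1%E. Proof. exact: rhoU.1. Qed.

(** The same with [rho] seen as a bare measure, which is how integrals mention it. *)
Let rhoSm : (rho : {measure set (n.-tuple R) -> \bar R}) S = 1%E.
Proof. exact: rhoU.1. Qed.

Let mS : measurable S := @measurable_unit_sphere R n.

(** The uniform law charges no set outside the sphere. *)
Lemma integral_unit_sphere (f : n.-tuple R -> \bar R) :
  measurable_fun setT f -> (forall v, 0 <= f v)%E ->
  (\int[rho]_v f v = \int[rho]_(v in S) f v)%E.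
Proof.
move=> mf f0.
rewrite (ge0_negligible_integral (N := ~` S))//.
- by rewrite setDE setCK setTI.
- exact: measurableC.
- by rewrite [LHS]probability_setC// rhoS subee.
Qed.

(** A reflection takes x to y and preserves the uniform law. *)
Lemma integral_dot_invariant (f : R -> \bar R) x y : dot x x = dot y y ->
  measurable_fun setT f -> (forall r, 0 <= f r)%E ->
  (\int[rho]_v f (dot x v) = \int[rho]_v f (dot y v))%E.
Proof.
move=> xy mf f0; have [Q orthQ Qxy] := reflection_exists xy.
have mQ := measurable_mx_act Q.
have mfx z : measurable_fun setT (fun v => f (dot z v)).
  by apply: measurableT_comp => //; exact: measurable_dot.
transitivity (\int[pushforward rho (mx_act Q)]_v f (dot x v))%E.
  by apply/esym; apply: eq_measure_integral => A mA _; exact: rhoU.2.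
rewrite (ge0_integral_pushforward mQ)//.
by rewrite preimage_setT; apply: eq_integral => v _; rewrite /= Qxy.
Qed.

Let i0 : 'I_n := Ordinal n0.

Let e0 (c : R) : n.-tuple R := [tuple if i == i0 then c else 0 | i < n].

Let dot_e0 c v : dot (e0 c) v = c * tnth v i0.
Proof.
rewrite /dot (bigD1 i0)//= tnth_mktuple eqxx big1 ?addr0// => i ii0.
by rewrite tnth_mktuple (negPf ii0) mul0r.
Qed.

Let E (f : n.-tuple R -> R) : R := \int[rho]_(v in S) f v.

Let mon a b (j : 'I_n) v := tnth v i0 ^+ a * tnth v j ^+ b.

Let mon_int a b j : rho.-integrable S (EFin \o mon a b j).
Proof.
have le1 i v : S v -> `|tnth v i| <= 1.
  move=> /unit_sphereE Sv; rewrite -(@expr_le1 _ 2)// real_normK ?num_real//.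
  rewrite -Sv /dot (bigD1 i)//= -expr2 lerDl.
  by apply: sumr_ge0 => k _; rewrite -expr2 sqr_ge0.
apply: (@le_integrable _ _ _ _ _ mS _ (EFin \o cst 1)).
- apply: measurable_funTS; apply/measurable_EFinP; apply: measurable_funM;
    by apply: measurable_funX; exact: measurable_tnth.
- move=> v Sv; rewrite /= lee_fin normr1 normrM !normrX.
  by rewrite mulr_ile1 ?exprn_ge0// exprn_ile1 ?le1.
- exact: finite_measure_integrable_cst.
Qed.

Let E_sum (I : eqType) (s : seq I) (h : I -> n.-tuple R -> R) :
  (forall i, rho.-integrable S (EFin \o h i)) ->
  E (fun v => \sum_(i <- s) h i v) = \sum_(i <- s) E (h i).
Proof.
move=> hint; elim: s => [|i s IH].
  rewrite big_nil /E; under eq_Rintegral do rewrite big_nil.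
  by rewrite Rintegral_cst// mul0r.
rewrite big_cons /E; under eq_Rintegral do rewrite big_cons.
rewrite RintegralD//; first by congr (_ + _); exact: IH.
have := @integrable_sum _ _ _ rho S mS _ s xpredT (fun i => EFin \o h i).
move=> /(_ (fun i _ => hint i)); apply: eq_integrable => // v _.
by rewrite /= -sumEFin.
Qed.

Let mu m := E (mon (2 * m) 0 i0).

Let muE m : (\int[rho]_v (tnth v i0 ^+ (2 * m))%:E = (mu m)%:E)%E.
Proof.
rewrite integral_unit_sphere.
- rewrite /mu /E /Rintegral fineK; last exact: integrable_fin_num (mon_int _ _ _).
  by apply: eq_integral => v _; rewrite /mon expr0 mulr1.
- by apply/measurable_EFinP; apply: measurable_funX; exact: measurable_tnth.
- by move=> v; rewrite lee_fin exprM exprn_ge0// sqr_ge0.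
Qed.

(** By invariance x may be replaced by a multiple of a basis vector. *)
Lemma integral_dot_pow m x :
  (\int[rho]_v (dot x v ^+ (2 * m))%:E = (dot x x ^+ m * mu m)%:E)%E.
Proof.
have xx : dot x x = dot (e0 (Num.sqrt (dot x x))) (e0 (Num.sqrt (dot x x))).
  by rewrite dot_e0 tnth_mktuple eqxx -expr2 sqr_sqrtr// dot_ge0.
rewrite (integral_dot_invariant (f := fun r => (r ^+ (2 * m))%:E) xx).
- under eq_integral do rewrite dot_e0 exprMn EFinM.
  rewrite ge0_integralZl//.
  + by rewrite muE -EFinM exprM sqr_sqrtr ?dot_ge0.
  + by apply/measurable_EFinP; apply: measurable_funX; exact: measurable_tnth.
  + by move=> v _; rewrite lee_fin exprM exprn_ge0// sqr_ge0.
- by apply/measurable_EFinP; exact: measurable_funX.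
- by move=> r; rewrite lee_fin exprM exprn_ge0// sqr_ge0.
Qed.

Let mu0 : mu 0 = 1.
Proof.
rewrite /mu /E /mon; under eq_Rintegral do rewrite !expr0 mulr1.
by rewrite Rintegral_cst// rhoSm mulr1.
Qed.

(** The even moment of v_0 + b v_j is (1 + b ^ 2) ^ m.+1 times that of v_0.
    Both sides are polynomials in b, and the coefficients of b ^ 2 give the
    mixed moment. *)
Let mixed m (j : 'I_n) : j != i0 ->
  (2 * m + 1)%:R * E (mon (2 * m) 2 j) = mu m.+1.
Proof.
move=> ji0.
pose p := \poly_(i < (2 * m.+1).+1) (E (mon (2 * m.+1 - i) i j) *+ 'C(2 * m.+1, i)).
pose q := mu m.+1 *: (1 + 'X^2 : {poly R}) ^+ m.+1.
have pq : p = q.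
  apply: poly_eq_eval => b.
  pose x : n.-tuple R := [tuple if i == i0 then 1 else if i == j then b else 0 | i < n].
  have dotx v : dot x v = tnth v i0 + b * tnth v j.
    rewrite /dot (bigD1 i0)//= (bigD1 j)//= !tnth_mktuple eqxx (negPf ji0) eqxx.
    rewrite mul1r big1 ?addr0// => i /andP[ii0 ij].
    by rewrite tnth_mktuple (negPf ii0) (negPf ij) mul0r.
  have xx : dot x x = 1 + b ^+ 2.
    by rewrite dotx !tnth_mktuple eqxx (negPf ji0) eqxx expr2.
  rewrite /q !hornerE -xx mulrC.
  have := integral_dot_pow m.+1 x; move=> /(congr1 fine) /= <-.
  rewrite integral_unit_sphere; last 2 first.
  - by apply/measurable_EFinP; apply: measurable_funX; exact: measurable_dot.
  - by move=> v; rewrite lee_fin exprM exprn_ge0// sqr_ge0.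
  rewrite -[RHS]/(E (fun v => dot x v ^+ (2 * m.+1))).
  pose h (i : 'I_(2 * m.+1).+1) v :=
    b ^+ i *+ 'C(2 * m.+1, i) * mon (2 * m.+1 - i) i j v.
  have hint i : rho.-integrable S (EFin \o h i).
    have := integrableZl mS (b ^+ i *+ 'C(2 * m.+1, i))
      (mon_int (2 * m.+1 - i) i j).
    by apply: eq_integrable => // v _; rewrite /= EFinM.
  transitivity (E (fun v => \sum_(i < (2 * m.+1).+1) h i v)); last first.
    rewrite /E; apply: eq_Rintegral => v _; rewrite dotx exprDn.
    apply: eq_bigr => i _; rewrite /h /mon exprMn mulrnAl; congr (_ *+ _).
    by rewrite mulrCA.
  rewrite E_sum// /p horner_poly; apply: eq_bigr => i _.
  by rewrite /E /h RintegralZl ?mon_int// mulrC mulrnAr mulrnAl.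
have := congr1 (fun r : {poly R} => r`_2) pq.
rewrite /p /q coef_poly coefZ coef2_1pX2_exp.
have -> : (2 < (2 * m.+1).+1)%N by rewrite mulnS.
have -> : (2 * m.+1 - 2 = 2 * m)%N by rewrite mulnS addKn.
rewrite bin2.
have -> : ((2 * m.+1 * (2 * m.+1).-1)./2 = m.+1 * (2 * m + 1))%N.
  by rewrite -mulnA mul2n doubleK mulnS add2n addn1.
rewrite -[_ *+ (_ * _)]mulr_natl natrM -mulrA [RHS]mulrC => H.
have m0 : m.+1%:R != 0 :> R by [].
exact: (mulfI m0).
Qed.

(** Multiply v_0 ^ (2 m) by 1, written as the sum of the squared coordinates,
    and evaluate the mixed moments. *)
Let mu_rec m : mu m.+1 = mu m * ((2 * m + 1)%:R / (n + 2 * m)%:R).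
Proof.
have H : mu m = \sum_(j < n) E (mon (2 * m) 2 j).
  rewrite -(@E_sum _ (index_enum 'I_n)); last by move=> j; exact: mon_int.
  rewrite /mu /E; apply: eq_Rintegral => v; rewrite inE => /unit_sphereE Sv.
  rewrite /mon -mulr_sumr expr0; congr (_ * _).
  by rewrite -Sv; apply: eq_bigr => i _; rewrite expr2.
have c0 : (2 * m + 1)%:R != 0 :> R by rewrite addn1.
have d0 : (n + 2 * m)%:R != 0 :> R by rewrite pnatr_eq0 addn_eq0 negb_and -lt0n n0.
have H2 : (2 * m + 1)%:R * mu m = (n + 2 * m)%:R * mu m.+1.
  rewrite H mulr_sumr (bigD1 i0)//=.
  under eq_bigr => j ji0 do rewrite mixed//.
  rewrite sumr_const cardC1 card_ord.
  have -> : E (mon (2 * m) 2 i0) = mu m.+1.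
    apply: eq_Rintegral => v _.
    by rewrite /mon expr0 mulr1 mulnS addnC exprD.
  rewrite -[_ *+ n.-1]mulr_natl -mulrDl -natrD; congr (_%:R * _).
  by rewrite -addnA add1n prednK// addnC.
by rewrite mulrA [mu m * _]mulrC H2 mulrAC divff// mul1r.
Qed.

Let mu_sphere_moment m : mu m = sphere_moment R n m.
Proof.
elim: m => [|m IH]; first by rewrite mu0 /sphere_moment big_ord0.
by rewrite mu_rec IH /sphere_moment big_ord_recr.
Qed.

Lemma integral_dot_even_pow m x :
  (\int[rho]_v (dot x v ^+ (2 * m))%:E = (dot x x ^+ m * sphere_moment R n m)%:E)%E.
Proof. by rewrite integral_dot_pow mu_sphere_moment. Qed.

Lemma integral_sqnorm_pow m : (\int[rho]_v (dot v v ^+ m)%:E = 1)%E.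
Proof.
rewrite integral_unit_sphere.
- transitivity (\int[rho]_(v in S) (cst 1 v))%E.
    by apply: eq_integral => v; rewrite inE => /unit_sphereE ->; rewrite expr1n.
  by rewrite integral_cst// mul1e rhoSm.
- by apply/measurable_EFinP; apply: measurable_funX; exact: measurable_sqnorm.
- by move=> v; rewrite lee_fin exprn_ge0// dot_ge0.
Qed.

End sphere_moments.

(** * Exponential moments of the overlap *)

(** The odd terms of the two exponential series cancel. *)
Lemma cosh_series (R : realType) (x : R) :
  (((expR x + expR (- x)) / 2)%:E =
   \sum_(0 <= m <oo) (x ^+ (2 * m) / (2 * m)`!%:R)%:E)%E.
Proof.
have cvgx y : series (exp_coeff y) @ \oo --> expR y.
  exact: is_cvg_series_exp_coeff.
pose s (N : nat) := (series (exp_coeff x) N + series (exp_coeff (- x)) N) / 2.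
have cvgs : s @ \oo --> (expR x + expR (- x)) / 2.
  by apply: cvgMl; apply: cvgD; exact: cvgx.
have evenN m : (- x) ^+ (2 * m) = x ^+ (2 * m) by rewrite exprM sqrrN -exprM.
have oddN m : (- x) ^+ (2 * m).+1 = - x ^+ (2 * m).+1.
  by rewrite exprS evenN mulNr -exprS.
have sE p : s (2 * p)%N = \sum_(0 <= m < p) (x ^+ (2 * m) / (2 * m)`!%:R).
  rewrite /s /series/= -big_split/=.
  elim: p => [|p IH]; first by rewrite muln0 !big_geq// mul0r.
  rewrite mulnS add2n !big_nat_recr//= /exp_coeff /= evenN oddN.
  by rewrite mulNr subrr addr0 mulrDl IH [in RHS](splitr (_ / _)) mulrDl.
have cvgs2 : (fun p => s (2 * p)%N) @ \oo --> (expR x + expR (- x)) / 2.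
  apply: (cvg_comp _ _ _ cvgs).
  apply/cvgnyPge => N; exists N => // p /= Np.
  by rewrite (leq_trans Np)// leq_pmull.
apply/esym/cvg_lim => //.
rewrite (_ : (fun n => _) = EFin \o (fun p => s (2 * p)%N)).
  by apply: cvg_comp cvgs2 _.
by apply/funext => p /=; rewrite sE sumEFin.
Qed.

Section overlap.
Context (R : realType) (n k : nat) (rho : 'I_k -> probability (n.-tuple R) R).
Variable nu : {measure set (k.-tuple (n.-tuple R)) -> \bar R}.
Hypotheses (n0 : (0 < n)%N) (k0 : (0 < k)%N).
Hypothesis rhoU : forall j, uniform_on_sphere (rho j).
Hypothesis nuE : product_law rho nu.
Implicit Types (v : k.-tuple (n.-tuple R)).

Definition overlap v v' : R := \prod_(j < k) dot (tnth v j) (tnth v' j).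

Lemma measurable_overlap v : measurable_fun setT (overlap v).
Proof.
apply: measurable_prod => j _; apply: (measurableT_comp (measurable_dot _)).
exact: measurable_tnth.
Qed.

Let j0 : 'I_k := Ordinal k0.

Let flip v : k.-tuple (n.-tuple R) :=
  [tuple if j == j0 then mx_act (- 1%:M) (tnth v j) else tnth v j | j < k].

Let measurable_flip : measurable_fun setT flip.
Proof.
apply/measurable_fun_tnthP => j.
rewrite (_ : _ \o _ = fun v =>
    if j == j0 then mx_act (- 1%:M) (tnth v j) else tnth v j); last first.
  by apply/funext => v; rewrite /= tnth_mktuple.
case: (j == j0); last exact: measurable_tnth.
by apply: (measurableT_comp (measurable_mx_act _)); exact: measurable_tnth.
Qed.

(** The uniform law on the sphere is symmetric, so the sign of one factor of
    the overlap can be changed; this removes its odd moments. *)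
Let flip_law A : measurable A -> nu (flip @^-1` A) = nu A.
Proof.
move=> mA; have [nuf nufE] := pushforward_measure nu measurable_flip.
rewrite -nufE; apply: (product_law_unique (rho := rho)) => // B mB.
pose C j := if j == j0 then mx_act (- 1%:M) @^-1` B j else B j.
have mC j : measurable (C j).
  rewrite /C; case: ifP => // _; rewrite -[X in measurable X]setTI.
  exact: (measurable_mx_act _ measurableT (mB j)).
transitivity (nu (rectangle C)).
  rewrite nufE; congr (nu _); apply/seteqP.
  split => v Bv j; have := Bv j; rewrite /= /C tnth_mktuple.
    by case: (j == j0).
  by case: (j == j0).
rewrite nuE//; congr EFin; apply: eq_bigr => j _; rewrite /C.
case: ifP => // _; congr fine; apply: (rhoU j).2 => //.
by rewrite linearN/= trmx1 mulmxN mulmx1 opprK.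
Qed.

Let overlap_flip v v' : overlap v (flip v') = - overlap v v'.
Proof.
rewrite /overlap (bigD1 j0)//= [in RHS](bigD1 j0)//= -mulNr; congr (_ * _).
  rewrite tnth_mktuple eqxx /dot -sumrN; apply: eq_bigr => i _.
  rewrite tnth_mktuple -mulrN; congr (_ * _).
  rewrite (bigD1 i)//= !mxE eqxx mulr1n mulN1r big1 ?addr0// => j ji.
  by rewrite !mxE eq_sym (negPf ji) oppr0 mul0r.
by apply: eq_bigr => j /negPf jj0; rewrite tnth_mktuple jj0.
Qed.

(** The inner integral is unchanged when the sign of the overlap is flipped, so
    the exponential may be replaced by the hyperbolic cosine.  All terms of the
    series are then nonnegative and can be integrated one by one; each factor
    of the overlap contributes the same sphere moment. *)
Lemma integral_exp_overlap (c : R) :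
  (\int[nu]_v \int[nu]_v' (expR (c * overlap v v'))%:E =
   \sum_(0 <= m <oo) (c ^+ (2 * m) / (2 * m)`!%:R * sphere_moment R n m ^+ k)%:E)%E.
Proof.
have mE v (a : R) : measurable_fun setT (fun v' => (expR (a * overlap v v'))%:E).
  apply/measurable_EFinP; apply: measurableT_comp => //.
  by apply: measurable_funM => //; exact: measurable_overlap.
have pow_ge0 (x : R) m : 0 <= x ^+ (2 * m) by rewrite exprM exprn_ge0// sqr_ge0.
have mom0 m : 0 <= sphere_moment R n m.
  by apply: prodr_ge0 => i _; rewrite divr_ge0.
have coef0 m : 0 <= c ^+ (2 * m) / (2 * m)`!%:R by rewrite divr_ge0.
have inner v : (\int[nu]_v' (expR (c * overlap v v'))%:E =
    \sum_(0 <= m <oo) (c ^+ (2 * m) / (2 * m)`!%:R * sphere_moment R n m ^+ k *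
      \prod_(j < k) dot (tnth v j) (tnth v j) ^+ m)%:E)%E.
  transitivity (\int[nu]_v' (((expR (c * overlap v v') +
      expR (- (c * overlap v v'))) / 2)%:E))%E.
    have h : (\int[nu]_v' (expR (c * overlap v v'))%:E =
              \int[nu]_v' (expR (- (c * overlap v v')))%:E)%E.
      transitivity (\int[pushforward nu flip]_v' (expR (c * overlap v v'))%:E)%E.
        by apply: eq_measure_integral => A mA _; exact/esym/flip_law.
      rewrite (ge0_integral_pushforward measurable_flip); first last.
      - by move=> v' _; rewrite lee_fin expR_ge0.
      - exact: mE.
      - exact: measurableT.
      rewrite preimage_setT; apply: eq_integral => v' _.
      by rewrite /= overlap_flip mulrN.
    have mN : measurable_fun setT (fun v' => (expR (- (c * overlap v v')))%:E).
      by under eq_fun do rewrite -mulNr; exact: mE.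
    under [RHS]eq_integral do rewrite mulrC EFinM EFinD.
    rewrite ge0_integralZl; first last.
    - by rewrite lee_fin invr_ge0.
    - by move=> v' _; rewrite adde_ge0// lee_fin expR_ge0.
    - exact: emeasurable_funD.
    - exact: measurableT.
    rewrite ge0_integralD; first last.
    - exact: mN.
    - by move=> v' _; rewrite lee_fin expR_ge0.
    - exact: mE.
    - by move=> v' _; rewrite lee_fin expR_ge0.
    - exact: measurableT.
    rewrite -h; set I := (\int[nu]_v' _)%E.
    have I0 : (0 <= I)%E by apply: integral_ge0 => v' _; rewrite lee_fin expR_ge0.
    rewrite (ge0_muleDr _ I0 I0) -ge0_muleDl; try by rewrite lee_fin invr_ge0.
    by rewrite -EFinD -[X in (X + _)%R]mul1r -[X in (_ + X)%R]mul1r -splitr mul1e.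
  under eq_integral do rewrite cosh_series.
  rewrite integral_nneseries//; last 2 first.
  - move=> m; apply/measurable_EFinP; apply: measurable_funM => //.
    apply: measurable_funX; apply: measurable_funM => //.
    exact: measurable_overlap.
  - by move=> m v' _; rewrite lee_fin divr_ge0.
  apply: eq_eseriesr => m _.
  transitivity (\int[nu]_v' ((c ^+ (2 * m) / (2 * m)`!%:R)%:E *
    (\prod_(j < k) dot (tnth v j) (tnth v' j) ^+ (2 * m))%:E))%E.
    apply: eq_integral => v' _; rewrite -EFinM; congr EFin.
    by rewrite exprMn mulrAC /overlap prodrXl.
  rewrite ge0_integralZl ?lee_fin//; last 2 first.
  - apply/measurable_EFinP; apply: measurable_prod => j _.
    apply: measurable_funX; apply: (measurableT_comp (measurable_dot _)).
    exact: measurable_tnth.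
  - by move=> v' _; rewrite lee_fin; apply: prodr_ge0.
  rewrite (integral_product_law (rho := rho)
    (g := fun j x => dot (tnth v j) x ^+ (2 * m))
    (c := fun j => dot (tnth v j) (tnth v j) ^+ m * sphere_moment R n m))//.
  - rewrite -EFinM big_split/= prodr_const card_ord; congr EFin.
    by rewrite -mulrA; congr (_ * _); rewrite mulrC.
  - by move=> j; apply: measurable_funX; exact: measurable_dot.
  - by move=> j; exact: integral_dot_even_pow.
under eq_integral do rewrite inner.
have D0 m v : 0 <= \prod_(j < k) dot (tnth v j) (tnth v j) ^+ m.
  by apply: prodr_ge0 => j _; rewrite exprn_ge0// dot_ge0.
have mD m : measurable_fun setT
    (fun v => \prod_(j < k) dot (tnth v j) (tnth v j) ^+ m).
  apply: measurable_prod => j _; apply: measurable_funX.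
  by apply: (measurableT_comp (@measurable_sqnorm R n)); exact: measurable_tnth.
rewrite integral_nneseries//; last 2 first.
- by move=> m; apply/measurable_EFinP; exact: measurable_funM.
- by move=> m v _; rewrite lee_fin mulr_ge0// mulr_ge0// exprn_ge0.
apply: eq_eseriesr => m _.
under eq_integral do rewrite EFinM.
rewrite ge0_integralZl//; last 3 first.
- exact/measurable_EFinP.
- by move=> v _; rewrite lee_fin.
- by rewrite lee_fin mulr_ge0// exprn_ge0.
rewrite (integral_product_law (rho := rho)
  (g := fun j x => dot x x ^+ m) (c := fun=> 1))//.
- by rewrite big1// mule1.
- by move=> j; apply: measurable_funX; exact: measurable_sqnorm.
- by move=> j x; rewrite exprn_ge0// dot_ge0.
- by move=> j; exact: integral_sqnorm_pow.
Qed.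

End overlap.

(** * The second moment method *)

Lemma tonelli d1 d2 (V : measurableType d1) (T : measurableType d2) (R : realType)
    (nu : probability V R) (m : probability T R) (f : V -> T -> \bar R) :
  measurable_fun setT (fun p : V * T => f p.1 p.2) ->
  (forall v z, 0 <= f v z)%E ->
  (\int[nu]_v \int[m]_z f v z = \int[m]_z \int[nu]_v f v z)%E.
Proof.
by move=> mf f0; apply: (fubini_tonelli (fun p : V * T => f p.1 p.2)).
Qed.

Section second_moment.
Context d1 d2 (V : measurableType d1) (T : measurableType d2) (R : realType).
Variables (nu : probability V R) (m0 m1 : probability T R) (ell : V -> T -> R).
Hypothesis mell : measurable_fun setT (fun p : V * T => ell p.1 p.2).
Hypothesis ell0 : forall v z, 0 <= ell v z.
Hypothesis m1E : forall A, measurable A ->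
  (m1 A = \int[nu]_v \int[m0]_(z in A) (ell v z)%:E)%E.

Let L z : \bar R := (\int[nu]_v (ell v z)%:E)%E.

Let L0 z : (0 <= L z)%E.
Proof. by apply: integral_ge0 => v _; rewrite lee_fin. Qed.

Let mellE : measurable_fun setT (fun p : V * T => (ell p.1 p.2)%:E).
Proof. exact/measurable_EFinP. Qed.

Let mL : measurable_fun setT L.
Proof.
apply: (measurable_fun_fubini_tonelli_G (fun p : V * T => (ell p.1 p.2)%:E)) => //.
by move=> p; rewrite lee_fin.
Qed.

Let mellv v : measurable_fun setT (ell v).
Proof.
have mp : measurable_fun setT (fun z : T => (v, z)) by exact: measurable_fun_pair.
exact: (measurableT_comp mell mp).
Qed.

Let mellz z : measurable_fun setT (ell ^~ z).
Proof.
have mp : measurable_fun setT (fun v : V => (v, z)) by exact: measurable_fun_pair.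
exact: (measurableT_comp mell mp).
Qed.

Let integral_L A : measurable A -> (\int[m0]_z ((\1_A z)%:E * L z) = m1 A)%E.
Proof.
move=> mA; rewrite m1E//.
have mA2 : measurable_fun setT (fun p : V * T => (\1_A p.2 : R)).
  have m1A : measurable_fun setT (\1_A : T -> R) by exact: measurable_indic.
  by apply: (measurableT_comp m1A); exact: measurable_snd.
transitivity (\int[nu]_v \int[m0]_z ((\1_A z)%:E * (ell v z)%:E))%E; last first.
  apply: eq_integral => v _; rewrite [RHS]integral_mkcond.
  by apply: eq_integral => z _; rewrite epatch_indic muleC.
rewrite tonelli.
- apply: eq_integral => z _; rewrite /L -ge0_integralZl//.
  + exact/measurable_EFinP.
  + by move=> v _; rewrite lee_fin.
- by apply: emeasurable_funM => //; exact/measurable_EFinP.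
- by move=> v z; rewrite mule_ge0 ?lee_fin.
Qed.

Let integral_L2 : (\int[m0]_z (L z * L z) =
  \int[nu]_v \int[nu]_v' \int[m0]_z (ell v z * ell v' z)%:E)%E.
Proof.
have mL2 : measurable_fun setT (fun p : V * T => L p.2).
  by apply: (measurableT_comp mL); exact: measurable_snd.
transitivity (\int[m0]_z \int[nu]_v ((ell v z)%:E * L z))%E.
  apply: eq_integral => z _; rewrite {1}/L -ge0_integralZr//.
  - exact/measurable_EFinP.
  - by move=> v _; rewrite lee_fin.
rewrite -tonelli.
- apply: eq_integral => v _; rewrite tonelli.
  + apply: eq_integral => z _; rewrite /L -ge0_integralZl ?lee_fin//.
    * exact/measurable_EFinP.
    * by move=> v' _; rewrite lee_fin.
  + apply/measurable_EFinP; apply: measurable_funM => //.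
    by apply: (measurableT_comp (mellv v)); exact: measurable_snd.
  + by move=> v' z; rewrite lee_fin mulr_ge0.
- exact: emeasurable_funM.
- by move=> v z; rewrite mule_ge0 ?lee_fin.
Qed.

(** Writing L for the density of m1, the inequality is the integral over m0 of
    (4 e + 2) L <= 4 e (1 + e) + 1 + L ^ 2 on A and 2 L <= 1 + L ^ 2 off A,
    which are the squares of L - (2 e + 1) and L - 1.  No integrability has to
    be known in advance, since all terms are nonnegative. *)
Lemma second_moment_bound (delta e : R) (A : set T) :
  (\int[nu]_v \int[nu]_v' \int[m0]_z (ell v z * ell v' z)%:E <= (1 + delta)%:E)%E ->
  0 < e -> measurable A ->
  fine (m1 A) <= (1 + e) * fine (m0 A) + delta / (4 * e).
Proof.
rewrite -integral_L2 => L2 e0 mA.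
pose a z : R := \1_A z.
have a0 z : 0 <= a z by [].
have ma : measurable_fun setT a by exact: measurable_indic.
have maE : measurable_fun setT (EFin \o a) by exact/measurable_EFinP.
have maL : measurable_fun setT (fun z => (a z)%:E * L z)%E by exact: emeasurable_funM.
have mLL : measurable_fun setT (fun z => L z * L z)%E by exact: emeasurable_funM.
have c4 : 0 <= 4 * e by rewrite mulr_ge0// ltW.
have c5 : 0 <= 4 * e * (1 + e) by rewrite mulr_ge0// addr_ge0// ltW.
have pointwise z : ((4 * e)%:E * ((a z)%:E * L z) + 2%:E * L z <=
    (4 * e * (1 + e))%:E * (a z)%:E + (1%:E + L z * L z))%E.
  have := L0 z; case: (L z) => [l l0| _|//].
    rewrite -!EFinM -!EFinD lee_fin /a indicE.
    case: (z \in A); rewrite /= ?mulr1n ?mulr0n.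
      have := sqr_ge0 (l - (2 * e + 1)); lra.
    have := sqr_ge0 (l - 1); lra.
  by rewrite [leRHS](_ : _ = +oo%E) ?leey// mulyy addey.
have intL : (\int[m0]_z L z = 1)%E.
  rewrite -(probability_setT m1) -integral_L//.
  by apply: eq_integral => z _; rewrite indicT mul1e.
have LHS : (\int[m0]_z ((4 * e)%:E * ((a z)%:E * L z) + 2%:E * L z) =
            (4 * e * fine (m1 A) + 2)%:E)%E.
  rewrite ge0_integralD; first last.
  - by apply: emeasurable_funM => //; exact: measurable_cst.
  - by move=> z _; rewrite mule_ge0 ?lee_fin.
  - by apply: emeasurable_funM => //; exact: measurable_cst.
  - by move=> z _; rewrite !mule_ge0 ?lee_fin.
  - exact: measurableT.
  rewrite ge0_integralZl ?lee_fin//; last by move=> z _; rewrite mule_ge0 ?lee_fin.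
  rewrite ge0_integralZl ?lee_fin// integral_L// intL mule1.
  by rewrite [in RHS]EFinD [in RHS]EFinM fineK ?fin_num_measure.
have RHS : (\int[m0]_z ((4 * e * (1 + e))%:E * (a z)%:E + (1%:E + L z * L z)) <=
            (4 * e * (1 + e) * fine (m0 A) + (1 + (1 + delta)))%:E)%E.
  rewrite ge0_integralD; first last.
  - by apply: emeasurable_funD => //; exact: measurable_cst.
  - by move=> z _; rewrite adde_ge0 ?mule_ge0 ?lee_fin.
  - by apply: emeasurable_funM => //; exact: measurable_cst.
  - by move=> z _; rewrite !mule_ge0 ?lee_fin.
  - exact: measurableT.
  rewrite ge0_integralZl ?lee_fin//; last by move=> z _; rewrite lee_fin.
  rewrite /a integral_indic// setIT [leRHS]EFinD.
  rewrite [X in (_ <= X + _)%E]EFinM fineK ?fin_num_measure// leeD2l//.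
  rewrite ge0_integralD; first last.
  - exact: mLL.
  - by move=> z _; rewrite mule_ge0.
  - exact: measurable_cst.
  - by move=> z _; rewrite lee_fin.
  - exact: measurableT.
  have -> : (\int[m0]_z 1%:E = 1)%E.
    by rewrite integral_cst// mul1e; exact: probability_setT.
  by rewrite [leRHS]EFinD leeD2l.
have : (4 * e * fine (m1 A) + 2 <=
    4 * e * (1 + e) * fine (m0 A) + (1 + (1 + delta)))%R.
  rewrite -lee_fin -LHS; apply: (le_trans _ RHS); apply: ge0_le_integral => //.
  - by move=> z _; rewrite adde_ge0 ?mule_ge0 ?lee_fin ?mule_ge0 ?lee_fin.
  - by apply: emeasurable_funD; apply: emeasurable_funM => //;
      exact: measurable_cst.
  - apply: emeasurable_funD.
      by apply: emeasurable_funM => //; exact: measurable_cst.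
    by apply: emeasurable_funD => //; exact: measurable_cst.
move=> main; have e4 : 0 < 4 * e by rewrite mulr_gt0.
rewrite -(ler_pM2l e4).
have : 4 * e * (delta / (4 * e)) = delta by field; rewrite gt_eqF.
by move: main; set q := delta / _; lra.
Qed.

End second_moment.

(** * Series that are dominated uniformly in a parameter *)

Section series_bounds.
Variable R : realType.
Implicit Types (s K x : R).

Lemma sum_geometric_le s p : 0 <= s < 1 -> \sum_(i < p) s ^+ i <= (1 - s)^-1.
Proof.
move=> /andP[s0 s1]; rewrite -[leRHS]mul1r ler_pdivlMr ?subr_gt0//.
have := subrX1 s p => h.
have -> : (\sum_(i < p) s ^+ i) * (1 - s) = 1 - s ^+ p.
  by rewrite mulrC -opprB mulNr -h opprB.
by rewrite gerBl exprn_ge0.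
Qed.

Lemma exists_geometric_le K s e : 0 <= s < 1 -> 0 < e ->
  exists M, K * s ^+ M <= e.
Proof.
move=> /andP[s0 s1] e0.
have h : (fun n => K * s ^+ n) @ \oo --> K * 0.
  by apply: cvgMr; apply: cvg_expr; rewrite ger0_norm.
rewrite mulr0 in h.
have /cvgrPdist_le /(_ _ e0) [M _ HM] := h.
exists M; have := HM M (leqnn M); rewrite /= sub0r normrN.
exact: le_trans (ler_norm _).
Qed.

Lemma exp_ge_term x N : 0 <= x -> x ^+ N / N`!%:R <= expR x.
Proof.
move=> x0.
have nd : nondecreasing_seq (series (exp_coeff x)).
  apply/nondecreasing_seqP => i; rewrite /series/= big_nat_recr//= lerDl.
  exact: exp_coeff_ge0.
have := nondecreasing_cvgn_le nd (is_cvg_series_exp_coeff x) N.+1.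
rewrite -[limn _]/(expR x); apply: le_trans.
rewrite /series/= big_nat_recr//= lerDr.
by apply: sumr_ge0 => i _; exact: exp_coeff_ge0.
Qed.

(** Write r as an exponential; half of its decay absorbs the power of m, since
    m is at most exp (eta m) / eta. *)
Lemma poly_mul_geometric_bounded r k : 0 <= r < 1 ->
  exists K s, [/\ 0 <= K, 0 <= s < 1 & forall m, m%:R ^+ k * r ^+ m <= K * s ^+ m].
Proof.
move=> /andP[r0 r1];
(* r may vanish, r' does not and has a logarithm. *)
pose r' := (1 + r) / 2.
have r'0 : 0 < r' by rewrite /r'; lra.
have r'1 : r' < 1 by rewrite /r'; lra.
have rr' : r <= r' by rewrite /r'; lra.
pose eta := - ln r' / (2 * k.+1%:R).
have lnr' : ln r' < 0 by rewrite ln_lt0// r'0.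
have k2 : 0 < 2 * k.+1%:R :> R by rewrite mulr_gt0.
have eta0 : 0 < eta by rewrite divr_gt0// oppr_gt0.
exists (eta^-1 ^+ k), (expR (ln r' / 2)); split.
- by rewrite exprn_ge0// invr_ge0 ltW.
- by rewrite expR_ge0 expR_lt1; lra.
move=> m.
have h1 : m%:R <= eta^-1 * expR (eta * m%:R).
  rewrite mulrC ler_pdivlMr// mulrC.
  have := expR_ge1Dx (eta * m%:R); lra.
have h2 : m%:R ^+ k <= eta^-1 ^+ k * expR (eta * m%:R) ^+ k.
  by rewrite -exprMn lerXn2r ?nnegrE// mulr_ge0 ?expR_ge0// invr_ge0 ltW.
have h3 : r ^+ m <= expR (ln r' * m%:R).
  by rewrite expRM_natr lnK ?posrE//; apply: lerXn2r; rewrite ?nnegrE// ltW.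
apply: (le_trans (ler_pM _ _ h2 h3)); rewrite ?exprn_ge0//.
rewrite -mulrA; apply: ler_wpM2l; first by rewrite exprn_ge0// invr_ge0 ltW.
rewrite -!expRM_natl -expRD ler_expR.
have -> : k%:R * (eta * m%:R) = - ln r' / 2 * m%:R * (k%:R / k.+1%:R).
  rewrite /eta; field.
  by rewrite nat1r pnatr_eq0.
have : k%:R / k.+1%:R <= 1 :> R by rewrite ler_pdivrMr// mul1r ler_nat.
have m0 : 0 <= m%:R :> R by [].
have : 0 <= - ln r' / 2 * m%:R by rewrite mulr_ge0// divr_ge0// oppr_ge0 ltW.
set A := - ln r' / 2 * m%:R; set B := k%:R / _ => A0 B1.
have : A * B <= A by rewrite ler_piMr.
by rewrite /A; lra.
Qed.

Lemma nneseries_le (u : nat -> R) (c : R) : (forall m, 0 <= u m) ->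
  (forall p, \sum_(m < p) u m <= c) ->
  (\sum_(0 <= m <oo) (u m)%:E <= c%:E)%E.
Proof.
move=> u0 uc; apply: lime_le.
  by apply: is_cvg_nneseries => m _ _; rewrite lee_fin.
by apply: nearW => p; rewrite sumEFin lee_fin big_mkord.
Qed.

(** The tail of the series is small uniformly in n by the geometric bound, and
    the finitely many terms before it (other than the first) tend to 0 as n
    grows. *)
Lemma uniform_tail (a : nat -> nat -> R) (C : nat -> R) K s delta :
  0 <= K -> 0 <= s < 1 -> 0 < delta ->
  (forall n m, 0 <= a n m) ->
  (forall n, a n 0 = 1) ->
  (forall n m, (0 < n)%N -> (0 < m)%N -> a n m <= K * s ^+ m) ->
  (forall n m, (0 < n)%N -> (0 < m)%N -> a n m <= C m / n%:R) ->
  exists N, forall n, (N <= n)%N ->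
    (\sum_(0 <= m <oo) (a n m)%:E <= (1 + delta)%:E)%E.
Proof.
move=> K0 s01 d0 a0 a1 aK aC.
have /andP[s0 s1] := s01.
have d20 : 0 < delta / 2 by rewrite divr_gt0.
(* The terms from M + 1 on contribute at most delta / 2. *)
have [M HM] := @exists_geometric_le (K / (1 - s)) s _ s01 d20.
pose C' := \sum_(m < M) `|C m.+1|.
have C'0 : 0 <= C' by apply: sumr_ge0.
exists (Num.truncn (C' / (delta / 2))).+1 => n nN; apply: nneseries_le => // p.
have n0 : (0 < n)%N by exact: leq_trans nN.
have nC : C' / n%:R <= delta / 2.
  rewrite ler_pdivrMr ?ltr0n// mulrC -ler_pdivrMr//.
  apply: ltW; apply: (lt_le_trans (truncnS_gt _)).
  by rewrite ler_nat.
apply: (@le_trans _ _ (\sum_(m < 1 + (M + p)) a n m)).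
  have [q ->] : exists q, (1 + (M + p) = p + q)%N.
    by exists (1 + M)%N; rewrite addnA addnC.
  by rewrite big_split_ord/= lerDl; exact: sumr_ge0.
rewrite !big_split_ord/= big_ord1 a1 lerD2l [leRHS](splitr delta) lerD//.
  apply: le_trans nC; rewrite /C' mulr_suml; apply: ler_sum => i _.
  apply: (le_trans (aC n _ n0 _)) => //.
  by rewrite ler_pM2r ?invr_gt0 ?ltr0n// ler_norm.
apply: le_trans HM.
apply: (@le_trans _ _ (\sum_(i < p) K * s ^+ M * s ^+ i)).
  apply: ler_sum => i _; apply: (le_trans (aK n _ n0 _)) => //.
  rewrite -mulrA -exprD ler_wpM2l// add1n exprS ler_piMl ?exprn_ge0//.
  exact: ltW.
rewrite -mulr_sumr [leRHS]mulrAC ler_wpM2l ?mulr_ge0 ?exprn_ge0//.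
exact: sum_geometric_le.
Qed.

End series_bounds.

(** * Size of the sphere moments *)

(** The term of index m in the series of the second moment of the likelihood
    ratio. *)
Definition chi_term (R : realType) (k : nat) (lambda : R) (n m : nat) : R :=
  (n%:R * lambda ^+ 2) ^+ (2 * m) / (2 * m)`!%:R * sphere_moment R n m ^+ k.

Section moment_bounds.
Variable R : realType.
Implicit Types (n m k : nat) (lambda x a b : R).

Lemma sphere_moment_ge0 n m : 0 <= sphere_moment R n m.
Proof. by apply: prodr_ge0 => i _; rewrite divr_ge0. Qed.

Lemma sphere_momentS n m :
  sphere_moment R n m.+1 = sphere_moment R n m * ((2 * m + 1)%:R / (n + 2 * m)%:R).
Proof. by rewrite /sphere_moment big_ord_recr. Qed.

Lemma chi_term_ge0 k lambda n m : 0 <= chi_term k lambda n m.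
Proof.
rewrite mulr_ge0 ?exprn_ge0 ?sphere_moment_ge0// divr_ge0//.
by rewrite exprM exprn_ge0// sqr_ge0.
Qed.

Lemma chi_term0 k lambda n : chi_term k lambda n 0 = 1.
Proof.
by rewrite /chi_term /sphere_moment muln0 big_ord0 expr1n fact0 divr1 mulr1 expr0.
Qed.

(** The quotient of consecutive terms is lambda ^ 4 times a factor at most 1. *)
Lemma chi_term2_le lambda n m : (0 < n)%N ->
  chi_term 2 lambda n m <= (lambda ^+ 4) ^+ m.
Proof.
move=> n0; elim: m => [|m IH]; first by rewrite chi_term0 expr0.
have n0R : 0 < n%:R :> R by rewrite ltr0n.
have m0 : 0 <= m%:R :> R by [].
have f0 : 0 < (2 * m)`!%:R :> R by rewrite ltr0n fact_gt0.
pose r : R := n%:R ^+ 2 * (2 * m + 1)%:R / ((2 * m + 2)%:R * (n + 2 * m)%:R ^+ 2).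
have e1 : (2 * m).+1%:R = 2 * m%:R + 1 :> R by rewrite -natr1 natrM.
have e2 : (2 * m).+2%:R = 2 * m%:R + 2 :> R by rewrite -addn2 natrD natrM.
have e3 : (2 * m + 1)%:R = 2 * m%:R + 1 :> R by rewrite natrD natrM.
have e4 : (n + 2 * m)%:R = n%:R + 2 * m%:R :> R by rewrite natrD natrM.
have e5 : (2 * m + 2)%:R = 2 * m%:R + 2 :> R by rewrite natrD natrM.
have -> : chi_term 2 lambda n m.+1 = chi_term 2 lambda n m * (lambda ^+ 4 * r).
  rewrite /chi_term sphere_momentS mulnS add2n !factS !natrM exprSr exprSr /r.
  rewrite e1 e2 e3 e4 e5; field.
  by rewrite !gt_eqF//; lra.
rewrite [leRHS]exprSr; apply: ler_pM => //; first exact: chi_term_ge0.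
  by rewrite mulr_ge0 ?exprn_even_ge0// divr_ge0// mulr_ge0// exprn_ge0.
rewrite ler_piMr ?exprn_even_ge0// /r ler_pdivrMr; last first.
  rewrite e4 e5; apply: mulr_gt0; first by lra.
  by apply: exprn_gt0; lra.
rewrite mul1r mulrC ler_pM ?exprn_ge0//.
  by rewrite ler_nat leq_add2l.
by rewrite lerXn2r ?nnegrE// ler_nat leq_addr.
Qed.

(** Apply ln u <= u - 1 to the two ratios of the arguments of the logarithms;
    the upper bounds add up to 0. *)
Lemma entropy_max a b x : 0 < a -> 0 < b -> 0 < x < 1 ->
  a * ln x + b * ln (1 - x) <= a * ln (a / (a + b)) + b * ln (b / (a + b)).
Proof.
move=> a0 b0 /andP[x0 x1]; have ab0 : 0 < a + b by rewrite addr_gt0.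
have lnle u : 0 < u -> ln u <= u - 1.
  by move=> u0; have := @le_ln1Dx _ (u - 1); rewrite [1 + _]addrC subrK; apply; lra.
have h (c y : R) : 0 < c -> 0 < y -> c * ln y - c * ln (c / (a + b)) <= y * (a + b) - c.
  move=> c0 y0; rewrite -mulrBr -ln_div ?posrE ?divr_gt0//.
  have u0 : 0 < y / (c / (a + b)) by rewrite !divr_gt0.
  have -> : y * (a + b) - c = c * (y / (c / (a + b)) - 1).
    by field; rewrite !gt_eqF.
  by apply: ler_wpM2l; [exact: ltW|exact: lnle].
have ha := h a x a0 x0.
have hb : b * ln (1 - x) - b * ln (b / (a + b)) <= (1 - x) * (a + b) - b.
  by apply: h => //; lra.
lra.
Qed.

(** The point where x ^ m (1 - x) ^ (n / 2) is maximal on the unit interval. *)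
Definition peak n m : R := (2 * m)%:R / (n + 2 * m)%:R.
(** The logarithm of that maximum. *)
Definition log_peak n m : R := m%:R * ln (peak n m) + n%:R / 2 * ln (1 - peak n m).

Lemma peak01 n m : (0 < n)%N -> (0 < m)%N -> 0 < peak n m < 1.
Proof.
move=> n0 m0; have d0 : 0 < (n + 2 * m)%:R :> R by rewrite ltr0n addn_gt0 n0.
apply/andP; split; first by apply: divr_gt0 => //; rewrite ltr0n muln_gt0.
rewrite /peak ltr_pdivrMr// mul1r ltr_nat.
by rewrite -[ltnLHS]add0n ltn_add2r.
Qed.

Lemma log_peak_max n m x : (0 < n)%N -> (0 < m)%N -> 0 < x < 1 ->
  m%:R * ln x + n%:R / 2 * ln (1 - x) <= log_peak n m.
Proof.
move=> n0 m0 x01.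
have m0R : 0 < m%:R :> R by rewrite ltr0n.
have n0R : 0 < n%:R / 2 :> R by rewrite divr_gt0// ltr0n.
have := entropy_max m0R n0R x01.
have -> : m%:R / (m%:R + n%:R / 2) = peak n m.
  rewrite /peak natrD natrM; field.
  by rewrite !gt_eqF//; lra.
have -> // : n%:R / 2 / (m%:R + n%:R / 2) = 1 - peak n m.
rewrite /peak natrD natrM; field.
by rewrite !gt_eqF//; lra.
Qed.

(** By induction on m.  The quotient of consecutive moments is the peak of
    index m times (2 m + 1) / (2 m), and evaluating the function of index m + 1
    at the peak of index m shows that the maximum is multiplied by at least
    that peak.  The remaining factors (2 m + 1) / (2 m) account for the factor m. *)
Lemma sphere_moment_le n m : (0 < n)%N ->
  sphere_moment R n m.+1 <= 3 / 2 * expR 1 * m.+1%:R * expR (log_peak n m.+1).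
Proof.
move=> n0; have n0R : 1 <= n%:R :> R by rewrite ler1n.
elim: m => [|m IH].
  rewrite sphere_momentS /sphere_moment big_ord0 mul1r muln0 addn0 add0n mulr1.
  rewrite /log_peak /peak muln1 mul1r natrD.
  set t : R := 2 / (n%:R + 2).
  have n2 : 0 < n%:R + 2 :> R by lra.
  have t01 : 0 < t by rewrite divr_gt0.
  have tE : 1 - t = (1 + 2 / n%:R)^-1.
    by rewrite /t; field; rewrite !gt_eqF//; lra.
  have n20 : 0 < 2 / n%:R :> R by rewrite divr_gt0//; lra.
  rewrite expRD [1%:R * ln t]mul1r lnK ?posrE// tE lnV ?posrE; last by lra.
  (* (1 + 2 / n) ^ (n / 2) <= exp 1, which is where the factor exp 1 of the bound
     comes from; the factor 3 / 2 bounds (n + 2) / (2 n). *)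
  have : expR (-1 : R) <= expR (n%:R / 2 * - ln (1 + 2 / n%:R)).
    rewrite ler_expR mulrN lerN2.
    have : ln (1 + 2 / n%:R) <= 2 / n%:R :> R by apply: le_ln1Dx; lra.
    move=> h; have : n%:R / 2 * ln (1 + 2 / n%:R) <= n%:R / 2 * (2 / n%:R) :> R.
      by apply: ler_wpM2l => //; rewrite divr_ge0//; lra.
    by have -> : n%:R / 2 * (2 / n%:R) = 1 :> R by field; rewrite gt_eqF//; lra.
  move=> h; apply: (@le_trans _ _ (3 / 2 * expR 1 * (t * expR (-1)))); last first.
    by rewrite ler_pM2l ?mulr_gt0 ?expR_gt0// ler_pM2l.
  have -> : 3 / 2 * expR 1 * (t * expR (-1)) = 3 / 2 * t * (expR 1 * expR (-1)) :> R.
    by ring.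
  rewrite -expRD subrr expR0 mulr1 /t.
  have -> : 3 / 2 * (2 / (n%:R + 2)) = 3 / (n%:R + 2) :> R.
    by field; rewrite gt_eqF.
  by rewrite ler_pdivlMr// ler_pdivrMl; lra.
rewrite sphere_momentS.
have x01 := @peak01 n m.+1 n0 isT.
have m1 : 0 < m.+1%:R :> R by [].
have d0 : 0 < (n + 2 * m.+1)%:R :> R by rewrite ltr0n addn_gt0 n0.
have step : expR (log_peak n m.+1) * peak n m.+1 <= expR (log_peak n m.+2).
  have /andP[xp _] := x01.
  rewrite -[X in _ * X](@lnK R (peak n m.+1)) ?posrE// -expRD ler_expR.
  have := @log_peak_max n m.+2 _ n0 isT x01; rewrite /log_peak -[m.+2%:R]natr1; lra.
have r0 : 0 <= (2 * m.+1 + 1)%:R / (n + 2 * m.+1)%:R :> R by rewrite divr_ge0.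
apply: (le_trans (ler_wpM2r r0 IH)).
have -> : (2 * m.+1 + 1)%:R / (n + 2 * m.+1)%:R =
    (1 + (2 * m.+1%:R)^-1) * peak n m.+1 :> R.
  by rewrite /peak [(2 * m.+1 + 1)%:R]natrD natrM; field; rewrite !gt_eqF//; lra.
set c := 3 / 2 * expR 1; have c0 : 0 <= c by rewrite mulr_ge0// expR_ge0.
have -> : c * m.+1%:R * expR (log_peak n m.+1) *
    ((1 + (2 * m.+1%:R)^-1) * peak n m.+1) =
   (c * (m.+1%:R + 2^-1)) * (expR (log_peak n m.+1) * peak n m.+1).
  by field; rewrite gt_eqF//; lra.
apply: ler_pM => //.
- by rewrite mulr_ge0//; lra.
- by rewrite mulr_ge0 ?expR_ge0//; have /andP[/ltW] := x01.
- by rewrite ler_wpM2l// -[m.+2%:R]natr1; lra.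
Qed.

Lemma sphere_moment_crude n m : (0 < n)%N ->
  sphere_moment R n m <= ((2 * m)%:R / n%:R) ^+ m.
Proof.
move=> n0; rewrite /sphere_moment -[X in _ ^+ X]card_ord -prodr_const.
apply: ler_prod => i _; rewrite divr_ge0//=.
apply: ler_pM => //.
  by rewrite ler_nat addn1 -[ltnLHS]/(2 * i)%N ltn_mul2l ltn_ord.
by rewrite lef_pV2 ?posrE ?ltr0n ?addn_gt0 ?n0// ler_nat leq_addr.
Qed.

End moment_bounds.

(** * Size of the second moment series below the critical value *)

Section chi_term_bounds.
Variable R : realType.
Implicit Types (n m k : nat) (lambda : R).

(** Take for q ^ 2 the peak that bounds the sphere moment.  The power of
    q ^ k coming from the k sphere moments combines with n lambda ^ 2 into
    a quantity that the hypothesis on lk bounds by theta ^ 2 X, where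
    X = - (n k / 2) ln (1 - q ^ 2).  The remaining factor exp (- X) beats
    X ^ (2 m) / (2 m)!, a term of the series of exp X. *)
Lemma chi_term_geometric k lambda lk theta n m : (0 < n)%N ->
  (forall q : R, 0 < q < 1 -> lk ^+ 2 * q ^+ k <= - (k%:R / 2) * ln (1 - q ^+ 2)) ->
  0 <= lambda -> 0 <= theta -> lambda <= theta * lk ->
  chi_term k lambda n m.+1 <=
    (3 / 2 * expR 1 * m.+1%:R) ^+ k * (theta ^+ 4) ^+ m.+1.
Proof.
move=> n0 lkP l0 t0 llk; set M := m.+1.
have x01 : 0 < peak R n M < 1 by exact: peak01.
have /andP[x0 x1] := x01.
set x := peak R n M in x01 x0 x1 *.
pose q := Num.sqrt x.
have q2 : q ^+ 2 = x by rewrite sqr_sqrtr// ltW.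
have q01 : 0 < q < 1.
  by rewrite sqrtr_gt0 x0/= -sqrtr1 ltr_sqrt.
pose X := - (n%:R * k%:R / 2 * ln (1 - x)).
have X0 : 0 <= X.
  rewrite /X -mulrN mulr_ge0 ?divr_ge0 ?mulr_ge0// oppr_ge0 ln_le0//; lra.
have peakE : expR (log_peak R n M) ^+ k = q ^+ k ^+ (2 * M) * expR (- X).
  rewrite /log_peak -/x expRD exprMn expRM_natl lnK ?posrE// -expRM_natl.
  rewrite -q2 -!exprM; congr (_ * expR _); last by rewrite /X q2; ring.
  by congr (_ ^+ _); ring.
have llk2 : n%:R * lambda ^+ 2 * q ^+ k <= theta ^+ 2 * X.
  have h1 : lambda ^+ 2 <= theta ^+ 2 * lk ^+ 2.
    by rewrite -exprMn lerXn2r ?nnegrE// (le_trans l0).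
  have qk0 : 0 <= q ^+ k by rewrite exprn_ge0// ltW//; case/andP: q01.
  have := lkP q q01; rewrite q2 => h2.
  have h3 : lambda ^+ 2 * q ^+ k <= theta ^+ 2 * (- (k%:R / 2) * ln (1 - x)).
    apply: (le_trans (ler_wpM2r qk0 h1)); rewrite -mulrA.
    by apply: ler_wpM2l => //; exact: sqr_ge0.
  rewrite -mulrA; apply: (le_trans (ler_wpM2l (ler0n R n) h3)).
  by rewrite le_eqVlt; apply/orP; left; apply/eqP; rewrite /X; ring.
have mom : sphere_moment R n M ^+ k <=
    (3 / 2 * expR 1 * M%:R) ^+ k * (q ^+ k ^+ (2 * M) * expR (- X)).
  rewrite -peakE -exprMn lerXn2r ?nnegrE ?sphere_moment_ge0//.
    exact: sphere_moment_le.
have f0 : 0 < (2 * M)`!%:R :> R by rewrite ltr0n fact_gt0.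
have a0 : 0 <= (n%:R * lambda ^+ 2) ^+ (2 * M) / (2 * M)`!%:R.
  by rewrite divr_ge0 ?exprn_ge0 ?mulr_ge0 ?sqr_ge0.
rewrite /chi_term; apply: (le_trans (ler_wpM2l a0 mom)).
rewrite mulrCA; apply: ler_wpM2l; first by rewrite exprn_ge0// !mulr_ge0 ?expR_ge0.
have -> : (n%:R * lambda ^+ 2) ^+ (2 * M) / (2 * M)`!%:R *
    (q ^+ k ^+ (2 * M) * expR (- X)) =
  (n%:R * lambda ^+ 2 * q ^+ k) ^+ (2 * M) * (expR (- X) / (2 * M)`!%:R).
  by rewrite [in RHS]exprMn; ring.
have h4 : (n%:R * lambda ^+ 2 * q ^+ k) ^+ (2 * M) <= (theta ^+ 2 * X) ^+ (2 * M).
  rewrite lerXn2r ?nnegrE//.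
  - by rewrite !mulr_ge0 ?sqr_ge0// exprn_ge0// ltW//; case/andP: q01.
  - by rewrite mulr_ge0 ?sqr_ge0.
have b0 : 0 <= expR (- X) / (2 * M)`!%:R by rewrite divr_ge0 ?expR_ge0.
apply: (le_trans (ler_wpM2r b0 h4)).
have -> : (theta ^+ 2 * X) ^+ (2 * M) * (expR (- X) / (2 * M)`!%:R) =
  (theta ^+ 4) ^+ M * (X ^+ (2 * M) / (2 * M)`!%:R * expR (- X)).
  rewrite exprMn -!exprM.
  have -> : (2 * (2 * M) = 4 * M)%N by rewrite mulnA.
  by ring.
rewrite ler_piMr ?exprn_ge0//.
rewrite expRN ler_pdivrMr ?expR_gt0// mul1r.
exact: exp_ge_term.
Qed.

(** The power of n is 2 m - k m, which is at most - 1 because k >= 3. *)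
Lemma chi_term_crude k lambda n m : (0 < n)%N -> (3 <= k)%N ->
  chi_term k lambda n m.+1 <=
    (lambda ^+ 2) ^+ (2 * m.+1) * ((2 * m.+1)%:R ^+ m.+1) ^+ k / n%:R.
Proof.
move=> n0 k3; set M := m.+1.
have nR : 0 < n%:R :> R by rewrite ltr0n.
have f1 : 1 <= (2 * M)`!%:R :> R by rewrite ler1n fact_gt0.
have f0 : 0 < (2 * M)`!%:R :> R by exact: lt_le_trans f1.
have l0 : 0 <= lambda ^+ 2 by exact: sqr_ge0.
have mom : sphere_moment R n M ^+ k <= ((2 * M)%:R ^+ M) ^+ k / n%:R ^+ (M * k).
  have := @sphere_moment_crude R n M n0; rewrite expr_div_n => h.
  by rewrite exprM -expr_div_n lerXn2r ?nnegrE ?sphere_moment_ge0//.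
have a0 : 0 <= (n%:R * lambda ^+ 2) ^+ (2 * M) / (2 * M)`!%:R.
  by apply: divr_ge0 => //; apply: exprn_ge0; apply: mulr_ge0.
rewrite /chi_term; apply: (le_trans (ler_wpM2l a0 mom)).
set B := ((2 * M)%:R ^+ M) ^+ k.
have B0 : 0 <= B by rewrite !exprn_ge0.
have -> : (n%:R * lambda ^+ 2) ^+ (2 * M) / (2 * M)`!%:R * (B / n%:R ^+ (M * k)) =
   (lambda ^+ 2) ^+ (2 * M) * B * (n%:R ^+ (2 * M) / n%:R ^+ (M * k) / (2 * M)`!%:R).
  by rewrite exprMn; ring.
apply: ler_wpM2l; first by apply: mulr_ge0 => //; exact: exprn_ge0.
rewrite ler_pdivrMr// ler_pdivrMr ?exprn_gt0//.
apply: (@le_trans _ _ (n%:R^-1 * n%:R ^+ (M * k))); last first.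
  by rewrite mulrAC -[leLHS]mulr1; apply: ler_wpM2l => //.
rewrite ler_pdivlMl// -exprS ler_weXn2l ?ler1n//.
apply: (@leq_trans (M * 3)); last by rewrite leq_pmul2l.
by rewrite (mulnC M) -[X in (_ <= X)%N]/(M + 2 * M)%N -add1n leq_add2r.
Qed.

End chi_term_bounds.


(** * The critical value *)

Section critical_value.
Variable R : realType.
Implicit Types (k : nat).

Let S k : set R :=
  [set Num.sqrt (- (k%:R / (2 * q ^+ k)) * ln (1 - q ^+ 2)) | q in `]0, 1[].

Let S_lb k : has_lbound (S k).
Proof. by exists 0 => _ [q _ <-]; exact: sqrtr_ge0. Qed.

Let half01 : (`]0, 1[%classic : set R) (2^-1).
Proof. by rewrite /= in_itv/=; apply/andP; split; lra. Qed.

Let S_neq0 k : S k !=set0.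
Proof. by eexists; exists 2^-1 => //; exact: half01. Qed.

Lemma lambda_2nd_energy k (q : R) : 0 < lambda_2nd R k -> 0 < q < 1 ->
  lambda_2nd R k ^+ 2 * q ^+ k <= - (k%:R / 2) * ln (1 - q ^+ 2).
Proof.
move=> lk0 q01; have /andP[q0 q1] := q01.
have qk0 : 0 < q ^+ k by rewrite exprn_gt0.
set A := - (k%:R / (2 * q ^+ k)) * ln (1 - q ^+ 2).
have h : lambda_2nd R k <= Num.sqrt A.
  by apply: (ge_inf (S_lb k)); exists q => //=; rewrite in_itv/= q01.
have A0 : 0 < A by rewrite -sqrtr_gt0; exact: lt_le_trans h.
have : lambda_2nd R k ^+ 2 <= A.
  by rewrite -[leRHS](sqr_sqrtr (ltW A0)) lerXn2r ?nnegrE ?sqrtr_ge0// ltW.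
rewrite -(ler_pM2r qk0) => /le_trans; apply.
rewrite le_eqVlt; apply/orP; left; apply/eqP; rewrite /A.
by field; rewrite gt_eqF//.
Qed.

Lemma lambda_2nd_scaling k : lambda_2nd R k = Num.sqrt (k%:R / 2) * beta_2nd R k.
Proof.
set c := Num.sqrt _; have c0 : 0 <= c by exact: sqrtr_ge0.
pose B := [set Num.sqrt (- (q ^+ k)^-1 * ln (1 - q ^+ 2)) | q in `]0, 1[] : set R.
have Blb : has_lbound B by exists 0 => _ [q _ <-]; exact: sqrtr_ge0.
have Bn0 : B !=set0 by eexists; exists 2^-1 => //; exact: half01.
have SB q : (`]0, 1[%classic : set R) q ->
    Num.sqrt (- (k%:R / (2 * q ^+ k)) * ln (1 - q ^+ 2)) =
    c * Num.sqrt (- (q ^+ k)^-1 * ln (1 - q ^+ 2)).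
  rewrite /= in_itv/= => /andP[q0 q1]; rewrite /c -sqrtrM ?divr_ge0//.
  by congr Num.sqrt; field; rewrite gt_eqF// exprn_gt0.
apply/eqP; rewrite eq_le; apply/andP; split.
  have [c00|cn0] := eqVneq c 0.
    rewrite c00 mul0r; have [_ [q q01 _]] := Bn0.
    by apply: (ge_inf (S_lb k)); exists q => //; rewrite SB// c00 mul0r.
  have cp : 0 < c by rewrite lt0r cn0.
  rewrite -ler_pdivrMl//; apply: lb_le_inf; first exact: Bn0.
  move=> _ [q q01 <-].
  rewrite ler_pdivrMl//; apply: (ge_inf (S_lb k)).
  by exists q => //; exact: SB.
apply: lb_le_inf; first exact: S_neq0.
move=> _ [q q01 <-]; rewrite SB//.
by apply: ler_wpM2l => //; apply: (ge_inf Blb); exists q.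
Qed.

(** The function - ln (1 - x) / x lies between 1 and 1 / (1 - x), so its infimum
    is its limit 1 at x = 0. *)
Lemma lambda_2nd_2 : lambda_2nd R 2 = 1.
Proof.
have S2 (q : R) : 0 < q -> - (2%:R / (2 * q ^+ 2)) * ln (1 - q ^+ 2) =
    - ln (1 - q ^+ 2) / q ^+ 2.
  by move=> q0; field; rewrite gt_eqF.
have q2 (q : R) : 0 < q < 1 -> 0 < q ^+ 2 < 1.
  by move=> /andP[q0 q1]; rewrite exprn_gt0//= exprn_ilt1// ltW.
have l1 : 1 <= lambda_2nd R 2.
  apply: lb_le_inf; first exact: S_neq0.
  move=> z [q /=]; rewrite in_itv/= => q01 <-.
  have /andP[q0 _] := q01; have /andP[x0 x1] := q2 _ q01.
  rewrite S2// -[leLHS]sqrtr1 ler_wsqrtr// ler_pdivlMr// mul1r.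
  have := @le_ln1Dx _ (- q ^+ 2); lra.
apply/eqP; rewrite eq_le l1 andbT leNgt; apply/negP => l1'.
set l := lambda_2nd R 2 in l1 l1' *.
have l2 : 1 < l ^+ 2 by rewrite exprn_egt1.
(* If the infimum l exceeded 1, this x would violate l ^ 2 (1 - x) <= 1. *)
pose x := (1 - (l ^+ 2)^-1) / 2; pose q := Num.sqrt x.
have li : 0 < (l ^+ 2)^-1 < 1 by rewrite invr_gt0 invf_lt1//; lra.
have /andP[li0 li1] := li.
have x0 : 0 < x by rewrite /x; lra.
have x1 : x < 1 by rewrite /x; lra.
have qx : q ^+ 2 = x by rewrite sqr_sqrtr// ltW.
have q01 : 0 < q < 1 by rewrite sqrtr_gt0 x0/= -sqrtr1 ltr_sqrt.
have lpos : 0 < l by lra.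
have := @lambda_2nd_energy 2 q lpos q01; rewrite -/l qx => h.
have lnx : - ln (1 - x) <= x / (1 - x).
  have -> : - ln (1 - x) = ln (1 + x / (1 - x)).
    rewrite -lnV ?posrE; last by lra.
    by congr ln; field; rewrite gt_eqF; lra.
  apply: le_ln1Dx; have : 0 <= x / (1 - x) by rewrite divr_ge0; lra.
  lra.
have : l ^+ 2 * x <= x / (1 - x) by lra.
rewrite ler_pdivlMr; last by lra.
have -> : l ^+ 2 * x * (1 - x) = x * ((l ^+ 2 + 1) / 2).
  by rewrite /x; field; rewrite gt_eqF//; lra.
rewrite -[leRHS]mulr1 ler_pM2l//; lra.
Qed.

End critical_value.

(** * Structure of the spiked tensor law *)

(** Independence of X and an event only has to be checked on rectangles: with
    the event fixed, both sides are finite measures in A. *)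
Lemma indep_rectangle_extend d d' (Omega : measurableType d) (T : measurableType d')
    (R : realType) (P : probability Omega R) (n : nat)
    (X : {RV P >-> n.-tuple T}) (D : set Omega) : measurable D ->
  (forall B, (forall i, measurable (B i)) ->
    P (X @^-1` rectangle B `&` D) = (P (X @^-1` rectangle B) * P D)%E) ->
  forall A, measurable A -> P (X @^-1` A `&` D) = (P (X @^-1` A) * P D)%E.
Proof.
move=> mD PB A mA.
have PD0 : 0 <= fine (P D) by rewrite fine_ge0.
pose m2 : {measure set (n.-tuple T) -> \bar R} :=
  mscale (NngNum PD0) (distribution P X).
have mX : measurable_fun setT X by exact: measurable_funPT.
have [m1 m1E] := pushforward_measure (mrestr P mD) mX.
have m2E C : m2 C = (P (X @^-1` C) * P D)%E.
  by rewrite /m2/= /mscale/= fineK ?fin_num_measure// muleC.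
have {}m1E C : m1 C = P (X @^-1` C `&` D) by rewrite m1E.
rewrite -m1E -m2E; apply: tuple_measure_eq mA => [|B mB].
  rewrite m1E preimage_setT setTI; apply: (@le_lt_trans _ _ 1%E).
    exact: probability_le1.
  exact: ltry.
by rewrite m1E m2E PB.
Qed.

(** [normal_prob] lives on a copy of the real line with another measurable
    structure display; this transports it to the one on which tuples are built. *)
Lemma normal_law_exists (R : realType) (s : R) : exists N : probability R R,
  forall A, measurable A -> N A = normal_prob 0 s A.
Proof.
have mid : measurable_fun setT (idfun : measurableTypeR R -> R).
  by move=> _ Y mY; rewrite setTI.
pose idR : {mfun measurableTypeR R >-> R} :=
  HB.pack (idfun : measurableTypeR R -> R) (isMeasurableFun.Build _ _ _ _ _ mid).
by exists (distribution (normal_prob (0 : R) s) idR) => A mA.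
Qed.

Section spike.
Context (R : realType) (k n : nat).
Notation N := #|{: k.-tuple 'I_n}|.
Notation V := (k.-tuple (n.-tuple R)).
Implicit Types (v : V) (lambda : R).

Definition spike lambda v (a : 'I_N) : R :=
  lambda * rank_one (fun j => tnth v j) (enum_val a).

Lemma measurable_spike lambda a : measurable_fun setT (spike lambda ^~ a).
Proof.
apply: measurable_funM => //; apply: measurable_prod => j _.
apply: (measurableT_comp (measurable_tnth (tnth (enum_val a) j))).
exact: measurable_tnth.
Qed.

(** The inner product of two rank-one tensors is the product of the inner
    products of their factors, by distributivity. *)
Lemma sum_spike lambda v v' :
  \sum_(a < N) spike lambda v a * spike lambda v' a = lambda ^+ 2 * overlap v v'.
Proof.
pose F j (i : 'I_n) := tnth (tnth v j) i * tnth (tnth v' j) i.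
transitivity (lambda ^+ 2 * \sum_(t : k.-tuple 'I_n) \prod_(j < k) F j (tnth t j)).
  rewrite mulr_sumr [RHS](reindex (fun a : 'I_N => enum_val a)) /=; last first.
    by exists enum_rank => t _; [exact: enum_valK|exact: enum_rankK].
  apply: eq_bigr => a _; rewrite /spike /rank_one /F big_split/=; ring.
congr (_ * _); rewrite (reindex (@tuple_of_finfun 'I_n k)) /=; last first.
  exists (@finfun_of_tuple 'I_n k) => t _;
    [exact: tuple_of_finfunK|exact: finfun_of_tupleK].
rewrite /overlap /dot (bigA_distr_bigA (fun j i => F j i)) /=.
by apply: eq_bigr => f _; apply: eq_bigr => j _;
  rewrite /tuple_of_finfun tnth_mktuple.
Qed.

End spike.

Section law.
Context (R : realType) (k n : nat).
Hypothesis n0 : (0 < n)%N.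
Notation N := #|{: k.-tuple 'I_n}|.
Notation V := (k.-tuple (n.-tuple R)).
Variable gauss : probability R R.
Hypothesis gaussE : forall A, measurable A ->
  gauss A = normal_prob 0 (Num.sqrt n%:R^-1) A.

Lemma shift_law_of_independent d (Omega : measurableType d) (P : probability Omega R)
    (lambda : R) (X : {RV P >-> V}) (Z : {RV P >-> tensor R k n}) :
  (forall A B, measurable A -> measurable B ->
    P (X @^-1` A `&` Z @^-1` B) = (P (X @^-1` A) * P (Z @^-1` B))%E) ->
  forall A, measurable A ->
  P ((fun w => shift (spike lambda (X w)) (Z w)) @^-1` A) =
  (\int[distribution P X]_v
    (distribution P Z) (shift (spike lambda v) @^-1` A))%E.
Proof.
move=> XZ A mA.
pose f (p : V * tensor R k n) : tensor R k n := shift (spike lambda p.1) p.2.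
have mf : measurable_fun setT f.
  apply/measurable_fun_tnthP => a.
  rewrite (_ : _ \o _ = fun p : V * tensor R k n => spike lambda p.1 a + tnth p.2 a).
    apply: measurable_funD.
      by apply: (measurableT_comp (measurable_spike lambda a)); exact: measurable_fst.
    by apply: (measurableT_comp (measurable_tnth a)); exact: measurable_snd.
  by apply/funext => p; rewrite /= tnth_mktuple.
have mS : measurable (f @^-1` A).
  by rewrite -[X in measurable X]setTI; exact: (mf measurableT _ mA).
have mXZ : measurable_fun setT (fun w => (X w, Z w)).
  by apply: measurable_fun_pair; exact: measurable_funPT.
have [m' m'E] := pushforward_measure P mXZ.
transitivity (m' (f @^-1` A)); first by rewrite m'E.
have := @product_measure_unique _ _ _ _ _ (distribution P X) (distribution P Z) m'.
move=> /(_ _ _ mS) <-; last by move=> B C mB mC; rewrite m'E; exact: XZ.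
apply: eq_integral => v _; congr (P (Z @^-1` _)).
by apply/seteqP; split => z; rewrite /xsection /= inE.
Qed.

(** Forgets the probability space: only the joint law of the signal and the
    noise matters, and independence makes it a product. *)
Lemma spiked_tensor_structure (lambda : R) (mu : probability (tensor R k n) R) :
  spiked_tensor_law lambda mu ->
  exists (rho : 'I_k -> probability (n.-tuple R) R) (nu : probability V R)
    (muZ : probability (tensor R k n) R),
    [/\ forall j, uniform_on_sphere (rho j), product_law rho nu,
        product_law (fun=> gauss) muZ &
        forall A, measurable A ->
          mu A = (\int[nu]_v muZ (shift (spike lambda v) @^-1` A))%E].
Proof.
move=> [d [W [P [Z [v [ZE vU indep muE]]]]]].
pose Zt w : tensor R k n := [tuple Z (enum_val a) w | a < N].
pose vt w : V := [tuple v j w | j < k].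
have mZt : measurable_fun setT Zt.
  apply/measurable_fun_tnthP => a.
  rewrite (_ : _ \o _ = Z (enum_val a)); first exact: measurable_funPT.
  by apply/funext => w; rewrite /= tnth_mktuple.
have mvt : measurable_fun setT vt.
  apply/measurable_fun_tnthP => j.
  rewrite (_ : _ \o _ = v j); first exact: measurable_funPT.
  by apply/funext => w; rewrite /= tnth_mktuple.
pose Zr : {RV P >-> tensor R k n} := HB.pack Zt (isMeasurableFun.Build _ _ _ _ _ mZt).
pose vr : {RV P >-> V} := HB.pack vt (isMeasurableFun.Build _ _ _ _ _ mvt).
have joint (a : 'I_N -> set R) (b : 'I_k -> set (n.-tuple R)) :
    (forall i, measurable (a i)) -> (forall j, measurable (b j)) ->
    P (vr @^-1` rectangle b `&` Zr @^-1` rectangle a) =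
    ((\prod_(j < k) fine (distribution P (v j) (b j))) *
     (\prod_(i < N) fine (gauss (a i))))%:E.
  move=> ma mb.
  pose J : {set k.-tuple 'I_n + 'I_k} := [set: _]%SET.
  have := indep J (fun s => match s with
    | inl t => Z t @^-1` a (enum_rank t)
    | inr j => v j @^-1` b j end).
  have -> : \bigcap_(i in [set` J])
      (fun s => match s with
        | inl t => Z t @^-1` a (enum_rank t)
        | inr j => v j @^-1` b j end) i =
      vr @^-1` rectangle b `&` Zr @^-1` rectangle a.
    apply/seteqP; split => [w H|w [Hb Ha] [t|j] _].
    - split => [j|i]; rewrite /= tnth_mktuple.
        by have := H (inr j); apply; rewrite /= inE.
      by have := H (inl (enum_val i)); rewrite /= enum_valK; apply; rewrite inE.
    - by have := Ha (enum_rank t); rewrite /= tnth_mktuple enum_rankK.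
    - by have := Hb j; rewrite /= tnth_mktuple.
  move=> ->; last first.
    by move=> [t|j] _; [exists (a (enum_rank t))|exists (b j)]; rewrite ?setTI.
  rewrite (eq_bigl xpredT); last by move=> s; rewrite inE.
  rewrite big_sumType/= mulrC; congr (_ * _)%:E.
  rewrite (reindex (fun i : 'I_N => enum_val i)) /=; last first.
    by exists enum_rank => t _; [exact: enum_valK|exact: enum_rankK].
  apply: eq_bigr => i _; rewrite enum_valK gaussE// -(ZE (enum_val i))//.
have vlaw : product_law (fun j => distribution P (v j)) (distribution P vr).
  move=> b mb; have := joint (fun=> setT) b (fun=> measurableT) mb.
  rewrite rectangleT preimage_setT setIT => h; apply: (etrans h); congr EFin.
  by rewrite [X in _ * X]big1 ?mulr1// => i _; rewrite probability_setT.
have Zlaw : product_law (fun=> gauss) (distribution P Zr).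
  move=> a ma; have := joint a (fun=> setT) ma (fun=> measurableT).
  rewrite rectangleT preimage_setT setTI => h; apply: (etrans h); congr EFin.
  by rewrite [X in X * _]big1 ?mul1r// => i _; rewrite probability_setT.
have mpre d' (T : measurableType d') (X : {RV P >-> T}) A :
    measurable A -> measurable (X @^-1` A).
  by move=> mA; rewrite -[X in measurable X]setTI; exact: measurable_funPT.
exists (fun j => distribution P (v j)), (distribution P vr), (distribution P Zr).
split => // A mA; rewrite muE//.
rewrite -shift_law_of_independent//.
  congr (P _); apply/seteqP; split => w /=.
    congr A; apply: eq_from_tnth => i; rewrite !tnth_mktuple /spike.
    by congr (_ * _ + _); apply: eq_bigr => j _; rewrite tnth_mktuple.
  congr A; apply: eq_from_tnth => i; rewrite !tnth_mktuple /spike.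
  by congr (_ * _ + _); apply: eq_bigr => j _; rewrite tnth_mktuple.
move=> B C mB mC.
apply: indep_rectangle_extend mB => //; first exact: mpre.
move=> b mb; rewrite setIC muleC.
apply: indep_rectangle_extend mC => //.
  by apply: mpre; exact: measurable_rectangle.
move=> a ma; rewrite setIC joint// muleC.
rewrite -[P (vr @^-1` _)]/(distribution P vr _) vlaw//.
by rewrite -[P (Zr @^-1` _)]/(distribution P Zr _) Zlaw// EFinM.
Qed.

End law.

(** * Comparison of the spiked and the null law *)

(** With lambda = 0 the spiked law is the Gaussian law itself, so both laws are
    expressed through the same Gaussian product law, for which the second
    moment bound is available. *)
Lemma spiked_tensor_comparison (R : realType) (k n : nat) (lambda delta e : R)
    (mu mu0 : probability (tensor R k n) R) (A : set (tensor R k n)) :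
  (0 < n)%N -> (0 < k)%N ->
  spiked_tensor_law lambda mu -> spiked_tensor_law 0 mu0 ->
  (\sum_(0 <= m <oo) (chi_term k lambda n m)%:E <= (1 + delta)%:E)%E ->
  0 < e -> measurable A ->
  fine (mu A) <= (1 + e) * fine (mu0 A) + delta / (4 * e).
Proof.
move=> n0 k0 mul mul0 chi e0 mA.
have [gauss gaussE] := normal_law_exists (Num.sqrt (n%:R^-1 : R)).
have [rho [nu [muZ [rhoU nuE muZE muE]]]] := spiked_tensor_structure gaussE mul.
have [rho' [nu' [muZ' [_ _ muZ'E mu0E]]]] := spiked_tensor_structure gaussE mul0.
have mu0Z B : measurable B -> mu0 B = muZ B.
  move=> mB; rewrite mu0E//.
  have id0 v : shift (spike 0 v) @^-1` B = B.
    apply/seteqP; split => z /=; rewrite (_ : shift _ z = z)//;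
      by apply: eq_from_tnth => a; rewrite tnth_mktuple /spike mul0r add0r.
  under eq_integral do rewrite id0.
  rewrite integral_cst// [X in (_ * X)%E](_ : _ = 1%E) ?mule1; last first.
    exact: probability_setT.
  exact: (product_law_unique muZ'E muZE).
rewrite mu0Z//.
pose ell (v : k.-tuple (n.-tuple R)) (z : tensor R k n) := tilt n (spike lambda v) z.
apply: (second_moment_bound (nu := nu) (ell := ell)) => //.
- apply: measurable_prod => a _; apply: measurableT_comp => //.
  have mz : measurable_fun setT
      (fun p : k.-tuple (n.-tuple R) * tensor R k n => tnth p.2 a).
    by apply: (measurableT_comp (measurable_tnth a)); exact: measurable_snd.
  have ms : measurable_fun setT
      (fun p : k.-tuple (n.-tuple R) * tensor R k n => spike lambda p.1 a).
    by apply: (measurableT_comp (measurable_spike lambda a)); exact: measurable_fst.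
  apply: measurable_funB.
    by apply: measurable_funM => //; exact: measurable_funM.
  apply: measurable_funM => //; apply: measurable_funM => //.
  exact: measurable_funX.
- by move=> v z; exact: tilt_ge0.
- move=> B mB; rewrite muE//; apply: eq_integral => v _.
  exact: (cameron_martin n0 gaussE).
- apply: le_trans chi.
  have -> : (\int[nu]_v \int[nu]_v' \int[muZ]_z (ell v z * ell v' z)%:E =
      \int[nu]_v \int[nu]_v' (expR (n%:R * lambda ^+ 2 * overlap v v'))%:E)%E.
    apply: eq_integral => v _; apply: eq_integral => v' _.
    by rewrite (integral_tilt2 n0 gaussE)// sum_spike mulrA.
  by rewrite (integral_exp_overlap n0 k0 rhoU nuE).
Qed.

Section second_moment_limits.
Variable R : realType.
Implicit Types (lambda delta : R) (k n : nat).

Lemma chi_sum2_bounded lambda : 0 <= lambda < 1 -> exists C, forall n, (0 < n)%N ->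
  (\sum_(0 <= m <oo) (chi_term 2 lambda n m)%:E <= (1 + C)%:E)%E.
Proof.
move=> /andP[l0 l1]; exists ((1 - lambda ^+ 4)^-1 - 1) => n n0.
apply: nneseries_le => [m|p]; first exact: chi_term_ge0.
rewrite addrC subrK.
apply: (@le_trans _ _ (\sum_(m < p) (lambda ^+ 4) ^+ m)).
  by apply: ler_sum => m _; exact: chi_term2_le.
by apply: sum_geometric_le; rewrite exprn_ge0//= exprn_ilt1.
Qed.

Lemma chi_sum_cvg1 k lambda delta : (3 <= k)%N -> 0 <= lambda ->
  lambda < lambda_2nd R k -> 0 < delta ->
  exists N, forall n, (N <= n)%N ->
  (\sum_(0 <= m <oo) (chi_term k lambda n m)%:E <= (1 + delta)%:E)%E.
Proof.
move=> k3 l0 llk d0; set lk := lambda_2nd R k in llk.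
have lk0 : 0 < lk by exact: le_lt_trans llk.
pose theta := lambda / lk.
have t0 : 0 <= theta by rewrite divr_ge0// ltW.
have t1 : theta < 1 by rewrite ltr_pdivrMr// mul1r.
have r01 : 0 <= theta ^+ 4 < 1 by rewrite exprn_ge0//= exprn_ilt1.
have [K [s [K0 s01 Ks]]] := poly_mul_geometric_bounded k r01.
have c0 : 0 <= 3 / 2 * expR 1 :> R by rewrite mulr_ge0// expR_ge0.
have aK n m : (0 < n)%N -> (0 < m)%N ->
    chi_term k lambda n m <= (3 / 2 * expR 1) ^+ k * K * s ^+ m.
  case: m => // m n0 _.
  have := @chi_term_geometric R k lambda lk theta n m n0
    (fun q => @lambda_2nd_energy R k q lk0) l0 t0.
  rewrite divfK ?gt_eqF// => /(_ (lexx _)) /le_trans; apply.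
  rewrite exprMn -!mulrA; apply: ler_wpM2l; last exact: Ks.
  by rewrite exprn_ge0.
apply: (@uniform_tail R (chi_term k lambda)
  (fun m => (lambda ^+ 2) ^+ (2 * m) * ((2 * m)%:R ^+ m) ^+ k) _ s _ _ s01 d0 _ _ aK).
- by rewrite mulr_ge0 ?exprn_ge0.
- exact: chi_term_ge0.
- exact: chi_term0.
- by move=> n [//|m] n0 _; exact: chi_term_crude.
Qed.

End second_moment_limits.

Theorem theorem6 (R : realType) :
  (forall k : nat, (2 <= k)%N ->
    lambda_2nd R k = Num.sqrt (k%:R / 2) * beta_2nd R k) /\
  lambda_2nd R 2 = 1 /\
  (forall (k : nat) (lambda : R)
      (Plambda P0 : forall n : nat, probability (tensor R k n) R),
    (2 <= k)%N -> 0 <= lambda -> lambda < lambda_2nd R k ->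
    (* n = 0 is excluded: the sphere is then empty *)
    (forall n : nat, (0 < n)%N -> spiked_tensor_law lambda (Plambda n)) ->
    (forall n : nat, (0 < n)%N -> spiked_tensor_law 0 (P0 n)) ->
    ((3 <= k)%N -> total_variation (Plambda n) (P0 n) @[n --> \oo] --> (0 : R)) /\
    (k = 2%N -> contiguous Plambda P0)).
Proof.
split; first by move=> k _; exact: lambda_2nd_scaling.
split; first exact: lambda_2nd_2.
move=> k lambda Plambda P0 k2 l0 llk HL H0.
have k0 : (0 < k)%N by exact: leq_trans k2.
split=> [k3|kE].
  apply/cvgrPdist_le => eps eps0.
  (* With delta = eps ^ 2 and e = eps / 2 both e and delta / (4 e) are eps / 2. *)
  have d0 : 0 < eps ^+ 2 by rewrite exprn_gt0.
  have e0 : 0 < eps / 2 by rewrite divr_gt0.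
  have [N HN] := chi_sum_cvg1 k3 l0 llk d0.
  exists N.+1 => // n /= nN.
  have n0 : (0 < n)%N by exact: leq_trans nN.
  have bound A : measurable A -> fine (Plambda n A) - fine (P0 n A) <= eps.
    move=> mA.
    have := spiked_tensor_comparison n0 k0 (HL n n0) (H0 n n0) (HN n (ltnW nN)) e0 mA.
    have -> : eps ^+ 2 / (4 * (eps / 2)) = eps / 2 by field; rewrite gt_eqF.
    have : eps / 2 * fine (P0 n A) <= eps / 2.
      rewrite ler_piMr ?(ltW e0)// -lee_fin fineK ?fin_num_measure//.
      exact: probability_le1.
    lra.
  have fineC (P : probability (tensor R k n) R) A : measurable A ->
      fine (P (~` A)) = 1 - fine (P A).
    by move=> mA; rewrite probability_setC// fineB ?fin_num_measure.
  (* The lower bound is the upper bound for the complement. *)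
  have abs_bound A : measurable A -> `|fine (Plambda n A) - fine (P0 n A)| <= eps.
    move=> mA; rewrite ler_norml bound// andbT.
    have := bound _ (measurableC mA); rewrite !fineC//; lra.
  rewrite sub0r normrN ger0_norm; last first.
    apply: ub_le_sup; last by exists set0 => //; rewrite !measure0 subrr normr0.
    by exists eps => _ [A mA <-]; exact: abs_bound.
  apply: ge_sup; last by move=> _ [A mA <-]; exact: abs_bound.
  by eexists; exists set0.
subst k => A mA /fine_cvgP[_ cvA].
have l1 : lambda < 1 by rewrite -(lambda_2nd_2 R).
have l01 : 0 <= lambda < 1 by rewrite l0.
have [C HC] := chi_sum2_bounded l01.
apply/fine_cvgP; split; first by apply: nearW => n; exact: fin_num_measure (mA n).
apply/cvgrPdist_le => eps eps0.
(* Large enough for C / (4 e) to be at most eps / 2. *)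
pose e := (`|C| + 1) / (2 * eps).
have e0 : 0 < e by rewrite divr_gt0 ?mulr_gt0// ltr_wpDl.
have eps'0 : 0 < eps / 2 / (1 + e) by rewrite !divr_gt0// addr_gt0.
move/cvgrPdist_le : cvA => /(_ _ eps'0) [N _ HN].
exists N.+1 => // n /= nN.
have n0 : (0 < n)%N by exact: leq_trans nN.
rewrite sub0r normrN ger0_norm ?fine_ge0//.
have := HN n (ltnW nN); rewrite /= sub0r normrN ger0_norm ?fine_ge0// => P0n.
apply: (le_trans
  (spiked_tensor_comparison n0 k0 (HL n n0) (H0 n n0) (HC n n0) e0 (mA n))).
rewrite [leRHS](splitr eps) lerD//.
  by rewrite mulrC -ler_pdivlMr// addr_gt0.
have -> : eps / 2 = (`|C| + 1) / (4 * e).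
  by rewrite /e; field; rewrite !gt_eqF// ltr_wpDl.
rewrite ler_pM2r; last by rewrite invr_gt0; apply: mulr_gt0.
by rewrite (le_trans (ler_norm C))// lerDl.
Qed.
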